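(* Let $g\colon\mathbb{R}^n\to(-\infty,+\infty]$ be proper, lower semicontinuous and $1$-strongly convex, $A\in\mathbb{R}^{m\times n}$, $b\in\mathbb{R}^m$, $f(x)=\frac12\|Ax-b\|^2$, and consider the problem $$\min_{x\in\mathbb{R}^n} g(x)\quad\text{s.t.}\quad x\in\operatorname{argmin} f.\qquad (P)$$ Assume that its solution set is $S=\{\bar x\}$. Let $\lambda>0$ with $\lambda\|A\|^2\le1$, let $\tau_0>0$, and set $$\tau_k=\frac{\tau_{k-1}}{\sqrt{1+\tau_{k-1}}}\ (k\ge1),\qquad \sigma_k=\frac{\lambda}{\tau_k}\ (k\ge0),\qquad \Sigma_k=\sigma_0+\dots+\sigma_k\ (k\ge0),\qquad \Sigma_{-1}=0.$$ Let $x^0\in\mathbb{R}^n$ be arbitrary, $s^0=x^0$, and let $(x^k)$, $(s^k)$ be generated for $k\ge0$ by $$z^k=\frac{\sigma_kx^k+\Sigma_{k-1}s^k}{\Sigma_k},\qquad x^{k+1}=\operatorname{prox}_{\tau_kg}\bigl(x^k-\tau_k\Sigma_k\nabla f(z^k)\bigr),\qquad s^{k+1}=\frac{\sigma_kx^{k+1}+\Sigma_{k-1}s^k}{\Sigma_k}.$$ Let $f_*=\min_xf(x)$, let $g_*$ be the optimal value of $(P)$, let $F_k(x)=g(x)+\Sigma_{k-1}(f(x)-f_* )$, and let $\hat x^k$ be the unique minimizer of $F_k$. Then: (i) $(s^k)$ converges to $\bar x$; $F_k(\hat x^k)-g_*\le F_k(s^k)-g_*=O(1/k^2)$, meaning that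 $F_k(s^k)-g_*\le C/k^2$ for some constant $C$ and all $k\ge1$; and $f(s^k)-f_*=o(1/k^2)$. (ii) If strong duality holds for $(P)$, then $(x^k)$ also converges to $\bar x$, at the rate $\|x^k-\bar x\|=O(1/k)$, and $f(x^k)-f_*=O(1/k^3)$, $f(s^k)-f_*=O(1/k^4)$, $|F_k(s^k)-g_*|=O(1/k^2)$, $|g(s^k)-g_*|=O(1/k^2)$.
   Context: $\mathbb{R}^n$ carries its inner product $\langle\cdot,\cdot\rangle$ and norm $\|\cdot\|$; $\|A\|$ is the operator norm. $g$ is $1$-strongly convex if $g-\frac12\|\cdot\|^2$ is convex. $\operatorname{prox}_{\tau g}(z)=\operatorname{argmin}_x\{\tau g(x)+\frac12\|x-z\|^2\}$; $\nabla f(x)=A^\top(Ax-b)$. Strong duality for $(P)$ means that there exists a saddle point $(x^*,u^* )\in\mathbb{R}^n\times\mathbb{R}^n$ of $\min_x\max_u\; g(x)+\langle u,A^\top Ax-A^\top b\rangle$ (so $x^*\in S$ and $0\in A^\top Au^*+\partial g(x^* )$). The $O(\cdot)$ and $o(\cdot)$ statements are as $k\to\infty$. *)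

(* Defs.v *)
From HB Require Import structures.
From mathcomp Require Import all_boot all_order all_algebra.
From mathcomp Require Import all_classical all_reals all_analysis.

Set Implicit Arguments.
Unset Strict Implicit.
Unset Printing Implicit Defensive.

Import Order.TTheory GRing.Theory Num.Theory.
Import numFieldNormedType.Exports.

Local Open Scope classical_set_scope.
Local Open Scope ring_scope.

(* The norm that the library puts on 'cV[R]_n is the sup norm: the Euclidean
   one is defined here.  Both induce the topology carried by 'cV[R]_n. *)
Definition dot (R : realType) (n : nat) (u v : 'cV[R]_n) : R :=
  \sum_(i < n) u i 0 * v i 0.

Definition enorm (R : realType) (n : nat) (u : 'cV[R]_n) : R :=
  Num.sqrt (dot u u).

Definition opnorm (R : realType) (m n : nat) (A : 'M[R]_(m, n)) : R :=
  sup [set enorm (A *m x) | x in [set x : 'cV[R]_n | enorm x <= 1]].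

Definition eproper (R : realType) (T : Type) (h : T -> \bar R) : Prop :=
  (forall x, h x != -oo%E) /\ (exists x, (h x < +oo)%E).

Definition econvex (R : realType) (n : nat) (h : 'cV[R]_n -> \bar R) : Prop :=
  forall (x y : 'cV[R]_n) (t : R), 0 < t < 1 ->
    (h (t *: x + (1 - t) *: y)%R <= t%:E * h x + (1 - t)%:E * h y)%E.

Definition strongly_convex1 (R : realType) (n : nat) (h : 'cV[R]_n -> \bar R) :
    Prop :=
  econvex (fun x => h x - (enorm x ^+ 2 / 2)%:E)%E.

(* Minimizers of h over D are required to have a value smaller than +oo: in
   particular argmin D h is empty when h is identically +oo on D. *)
Definition argmin (R : realType) (T : Type) (D : set T) (h : T -> \bar R) :
    set T :=
  [set x | [/\ D x, (h x < +oo)%E & forall y, D y -> (h x <= h y)%E]].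

(* A minimizer of h over the whole space, if there is one, and 0 otherwise. *)
Definition minimizer (R : realType) (n : nat) (h : 'cV[R]_n -> \bar R) :
    'cV[R]_n :=
  xget 0 (argmin setT h).

(* prox tau g is the proximal operator of tau * g. *)
Definition prox (R : realType) (n : nat) (tau : R) (g : 'cV[R]_n -> \bar R)
    (z : 'cV[R]_n) : 'cV[R]_n :=
  minimizer (fun x => tau%:E * g x + (enorm (x - z) ^+ 2 / 2)%:E)%E.

Section LeastSquares.
Context {R : realType} {m n : nat}.
Variables (A : 'M[R]_(m, n)) (b : 'cV[R]_m).

Definition lsq (x : 'cV[R]_n) : R := enorm (A *m x - b) ^+ 2 / 2.

Definition lsq_grad (x : 'cV[R]_n) : 'cV[R]_n := A^T *m (A *m x - b).

Definition lsq_min : R := inf (range lsq).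

Definition lsq_argmin : set 'cV[R]_n := argmin setT (fun x => (lsq x)%:E).

(* Here g is the objective that is minimized over the set lsq_argmin. *)
Variable g : 'cV[R]_n -> \bar R.

Definition solution_set : set 'cV[R]_n := argmin lsq_argmin g.

Definition optimal_value : \bar R := ereal_inf (g @` lsq_argmin).

Definition penalized (c : R) (x : 'cV[R]_n) : \bar R :=
  (g x + (c * (lsq x - lsq_min))%:E)%E.

Definition lagrangian (x u : 'cV[R]_n) : \bar R :=
  (g x + (dot u (A^T *m A *m x - A^T *m b))%:E)%E.

Definition strong_duality : Prop :=
  exists xs us : 'cV[R]_n, forall x u : 'cV[R]_n,
    (lagrangian xs u <= lagrangian xs us)%E /\
    (lagrangian xs us <= lagrangian x us)%E.

End LeastSquares.

(* |u k| = O(|v k|) as k tends to infinity, for an extended-real valued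
   sequence u; in particular u k is eventually finite. *)
Definition ebigO (R : realType) (u : nat -> \bar R) (v : nat -> R) : Prop :=
  exists C : R, \forall k \near \oo, (`|u k| <= (C * `|v k|)%:E)%E.

(* Main.v *)
Require Import Defs.
From HB Require Import structures.
From mathcomp Require Import all_boot all_order all_algebra.
From mathcomp Require Import all_classical all_reals all_analysis.
From mathcomp Require Import ring lra.

Import Order.TTheory GRing.Theory Num.Theory.
Import numFieldNormedType.Exports.

Set Implicit Arguments.
Unset Strict Implicit.
Unset Printing Implicit Defensive.

Local Open Scope classical_set_scope.
Local Open Scope ring_scope.

(** Write X k = x k - xbar, let Sg k be the sum of the first k step weights
    sigma, and S k = Sg k *: (s k - xbar), so that
    S k.+1 = S k + sigma k *: X k.+1.
    Since the gradient of f at y is A^T A (y - xbar), the gradient term of the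
    algorithm is A^T A (S k + sigma k X k): the method is a primal-dual method
    whose dual variable is A S k, and f (s k) - f_* = |A S k|^2 / (2 (Sg k)^2).

    Energy (energy_step, energy_sum).  The optimality condition of the proximal
    step gives a subgradient of g at x k.+1 (prox_subgrad).  Test it at xbar and
    multiply by sigma k: the gradient term telescopes into |A S k|^2 / 2, and
    the strong convexity of g raises the weight of |X k.+1|^2 from sigma k ^+ 2
    to sigma k ^+ 2 + lambda sigma k, which is sigma k.+1 ^+ 2 by the choice of
    the steps.  Summing up,
      sum_(j < k) sigma j (g (x j.+1) - g_* ) + |A S k|^2 / 2
        + sigma k ^+ 2 |X k|^2 / (2 lambda)
        + sum_(j < k) sigma j ^+ 2 (|A X j|^2 + |x j.+1 - x j|_P^2) / 2
    is at most its value D at k = 0, where P = I / lambda - A^T A is positive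
    semidefinite.  As sigma grows linearly (sigma_ge_linear), Sg k is at least
    of order k^2, and Jensen's inequality turns the energy bound into
    F_k (s k) - g_* <= D / Sg k (penalized_average_le).

    Convergence of the averages (xhat_cvg, average_cvg).  The minimal values of
    F_k increase and are bounded by g_*, hence quadratic growth makes their
    minimizers a Cauchy sequence; its limit is feasible with value at most g_*,
    so it is xbar, and the minimal values tend to g_*.  Quadratic growth once
    more gives s k --> xbar.  Then liminf g (s k) >= g_*, and the bound on
    F_k (s k) leaves Sg k (f (s k) - f_* ) = o(1).

    Rates under strong duality.  A saddle point provides v with
    g y - g_* >= - <v, A (y - xbar)> (strong_duality_multiplier), hence the
    first sum of the energy is at least - <v, A S k>, which the term in |A S k|^2
    absorbs, and all the terms are bounded (energy_multiplier).  This yields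
    every rate except f (x k) - f_* = O(k^-3), for which single terms of the last
    sum only give O(k^-2).  But the residual |A X k.+1|^2 + |x k.+1 - x k|_P^2 is
    nonincreasing (residual_nincr), by monotonicity of the subdifferential of g
    between consecutive steps, and a nonincreasing sequence that is summable
    against sigma j ^+ 2 is at most of the order of the inverse of the sum of
    these weights (residual_le_dissipation). *)

(** * Euclidean space *)

Section Euclidean.
Context {R : realType}.

Section Dot.
Context {n : nat}.
Implicit Types u v w : 'cV[R]_n.

Lemma dotC u v : dot u v = dot v u.
Proof. by apply: eq_bigr => i _; rewrite mulrC. Qed.

Lemma dotDl u v w : dot (u + v) w = dot u w + dot v w.
Proof. by rewrite -big_split; apply: eq_bigr => i _; rewrite mxE mulrDl. Qed.

Lemma dotZl a u v : dot (a *: u) v = a * dot u v.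
Proof. by rewrite big_distrr /=; apply: eq_bigr => i _; rewrite mxE mulrA. Qed.

Lemma dotNl u v : dot (- u) v = - dot u v.
Proof. by rewrite -scaleN1r dotZl mulN1r. Qed.

Lemma dotDr u v w : dot w (u + v) = dot w u + dot w v.
Proof. by rewrite dotC dotDl !(dotC w). Qed.

Lemma dotZr a u v : dot u (a *: v) = a * dot u v.
Proof. by rewrite dotC dotZl dotC. Qed.

Lemma dotNr u v : dot u (- v) = - dot u v.
Proof. by rewrite dotC dotNl dotC. Qed.

Lemma dot0l v : dot 0 v = 0.
Proof. by rewrite -(scale0r (0 : 'cV[R]_n)) dotZl mul0r. Qed.

Definition dotE := (dotDl, dotDr, dotNl, dotNr, dotZl, dotZr).

Lemma dot_ge0 u : 0 <= dot u u.
Proof. by apply: sumr_ge0 => i _; rewrite -expr2 sqr_ge0. Qed.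

Lemma dot_eq0 u : dot u u = 0 -> u = 0.
Proof.
move=> /eqP; rewrite psumr_eq0 => [/allP u0|i _]; last by rewrite -expr2 sqr_ge0.
apply/matrixP => i j; rewrite ord1 mxE.
by have := u0 i (mem_index_enum i); rewrite mulf_eq0 orbb => /eqP.
Qed.

Lemma enorm_ge0 u : 0 <= enorm u.
Proof. exact: sqrtr_ge0. Qed.

Lemma enorm_sqr u : enorm u ^+ 2 = dot u u.
Proof. by rewrite sqr_sqrtr // dot_ge0. Qed.

Lemma enormZ a u : enorm (a *: u) = `|a| * enorm u.
Proof.
by rewrite /enorm dotZl dotZr mulrA -expr2 sqrtrM ?sqr_ge0 // sqrtr_sqr.
Qed.

Lemma enormN u : enorm (- u) = enorm u.
Proof. by rewrite -scaleN1r enormZ normrN1 mul1r. Qed.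

(** Expand the square of the norm of (v.v) u - (u.v) v. *)
Lemma dot_le_enorm u v : dot u v <= enorm u * enorm v.
Proof.
have [v0|v0] := eqVneq (dot v v) 0.
  by rewrite (dot_eq0 v0) dotC dot0l mulr_ge0 ?enorm_ge0.
rewrite (le_trans (ler_norm _)) // -ler_sqr ?nnegrE ?mulr_ge0 ?enorm_ge0 //.
rewrite (real_normK (num_real _)) exprMn !enorm_sqr.
have vgt0 : 0 < dot v v by rewrite lt_def v0 dot_ge0.
have := dot_ge0 (dot v v *: u - dot u v *: v).
rewrite !dotE (dotC v u) => h; rewrite -subr_ge0.
by rewrite -(pmulr_rge0 _ vgt0); lra.
Qed.

Lemma enormD u v : enorm (u + v) <= enorm u + enorm v.
Proof.
rewrite -ler_sqr ?nnegrE ?addr_ge0 ?enorm_ge0 //.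
rewrite sqrrD !enorm_sqr !dotE (dotC v u).
by have := dot_le_enorm u v; lra.
Qed.

Lemma norm_le_enorm u : `|u| <= enorm u.
Proof.
have [->|u0] := eqVneq `|u| 0; first exact: enorm_ge0.
have [[i j] uij] := mx_norm_neq0 u0.
rewrite -[leLHS]/(mx_norm u) uij /= ord1.
rewrite -ler_sqr ?nnegrE ?enorm_ge0 // (real_normK (num_real _)) enorm_sqr.
rewrite /dot (bigD1 i) //=.
by rewrite -expr2 lerDl sumr_ge0 // => k _; rewrite -expr2 sqr_ge0.
Qed.

Lemma enorm_le_norm u : enorm u <= n%:R * `|u|.
Proof.
rewrite -ler_sqr ?nnegrE ?enorm_ge0 ?mulr_ge0 //.
have [n0|n0] := posnP n.
  rewrite enorm_sqr exprMn /dot big1 ?mulr_ge0 ?sqr_ge0 // => -[i hi] _.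
  by exfalso; move: (hi); rewrite n0.
rewrite enorm_sqr exprMn (@le_trans _ _ (n%:R * `|u| ^+ 2)) //; last first.
  by rewrite ler_wpM2r ?sqr_ge0 // expr2 ler_peMr // ler1n.
have -> : n%:R * `|u| ^+ 2 = \sum_(i < n) `|u| ^+ 2.
  by rewrite sumr_const card_ord mulr_natl.
apply: ler_sum => i _; rewrite -expr2 -(real_normK (num_real (u i 0))).
rewrite ler_sqr ?nnegrE // -[leRHS]/(mx_norm u) mx_normrE.
exact: (le_bigmax _ _ (i, 0)).
Qed.

End Dot.

Lemma dot_mulmxl m n (A : 'M[R]_(m, n)) u v :
  dot (A *m u) v = dot u (A^T *m v).
Proof.
rewrite /dot; under eq_bigr do rewrite mxE big_distrl /=.
rewrite exchange_big; apply: eq_bigr => j _.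
by rewrite mxE big_distrr /=; apply: eq_bigr => i _; rewrite /= !mxE; ring.
Qed.

End Euclidean.

(** * Topology in terms of the Euclidean norm *)

Section Topology.
Context {R : realType} {n : nat}.
Implicit Types (u : nat -> 'cV[R]_n) (l : 'cV[R]_n) (h : 'cV[R]_n -> \bar R).

(** The topology of 'cV[R]_n comes from the sup norm, which norm_le_enorm and
    enorm_le_norm show to be equivalent to the Euclidean norm. *)
Lemma nbhs_enormP l (V : set 'cV[R]_n) :
  nbhs l V <-> exists2 r : R, 0 < r & forall y, enorm (y - l) < r -> V y.
Proof.
split=> [/nbhs_ballP[r /= r0 lV]|[r r0 lV]].
  exists r => // y yl; apply: lV; rewrite mx_norm_ball /ball_ /= distrC.
  exact: le_lt_trans (norm_le_enorm _) yl.
apply/nbhs_ballP; exists (r / n.+1%:R); first by rewrite /= divr_gt0.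
move=> y; rewrite mx_norm_ball /ball_ /= distrC ltr_pdivlMr // => yl.
apply: lV; apply: le_lt_trans (enorm_le_norm _) (le_lt_trans _ yl).
by rewrite mulrC ler_wpM2l // ler_nat.
Qed.

Lemma cvg_enormP u l :
  u @ \oo --> l <->
  forall e : R, 0 < e -> \forall k \near \oo, enorm (u k - l) < e.
Proof.
split=> [ul e e0|ul V /nbhs_enormP[r r0 lV]].
  by apply: (ul [set y | enorm (y - l) < e]); apply/nbhs_enormP; exists e.
by apply: filterS (ul r r0) => k; exact: lV.
Qed.

Lemma lsc_enormP h :
  lower_semicontinuous h <->
  forall x a, (a%:E < h x)%E ->
    exists2 r : R, 0 < r & forall y, enorm (y - x) < r -> (a%:E < h y)%E.
Proof.
split=> hP x a /hP.
  by move=> [V /nbhs_enormP[r r0 xV] Va]; exists r => // y /xV /Va.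
move=> [r r0 hr]; exists [set y | (a%:E < h y)%E] => //.
by apply/nbhs_enormP; exists r.
Qed.

Lemma enorm_cauchy_cvg u (e : nat -> R) :
  (forall k j, (k <= j)%N -> enorm (u j - u k) ^+ 2 <= e k) ->
  e @ \oo --> 0 -> exists l, u @ \oo --> l.
Proof.
move=> ue e0; suff /cvg_ex[l ul] : cvg (u @ \oo) by exists l.
apply: cauchy_cvg; apply/cauchyP => r r0.
have r20 : 0 < r ^+ 2 by rewrite exprn_gt0.
move/cvgrPdist_lt : e0 => /(_ _ r20)[K _ eK]; exists (u K).
exists K => // j /= Kj; rewrite mx_norm_ball /ball_ /= distrC.
apply: le_lt_trans (norm_le_enorm _) _.
rewrite -ltr_sqr ?nnegrE ?enorm_ge0 ?ltW //; apply: le_lt_trans (ue _ _ Kj) _.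
by have := eK K (leqnn K); rewrite sub0r normrN; apply: le_lt_trans (ler_norm _).
Qed.

Lemma ereal_between (r : R) (v : \bar R) :
  (r%:E < v)%E -> exists2 a : R, r < a & (a%:E < v)%E.
Proof.
case: v => [v||//]; rewrite ?lte_fin.
  by move=> /midf_lt[? ?]; exists ((r + v) / 2); rewrite ?lte_fin.
by exists (r + 1); rewrite ?ltry ?ltrDl.
Qed.

Lemma lsc_near h u l (a : R) : lower_semicontinuous h -> u @ \oo --> l ->
  (a%:E < h l)%E -> \forall k \near \oo, (a%:E < h (u k))%E.
Proof.
move=> hl ul /hl[W lW Wa].
have : \forall k \near \oo, W (u k) by exact: (ul W lW).
by apply: filterS => k /Wa.
Qed.

Lemma lsc_le_lim h u l (c : R) : lower_semicontinuous h -> u @ \oo --> l ->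
  (forall e : R, 0 < e -> \forall k \near \oo, (h (u k) <= (c + e)%:E)%E) ->
  (h l <= c%:E)%E.
Proof.
move=> hl ul hc; rewrite leNgt; apply/negP => /ereal_between[a ca al].
have /hc huc : 0 < a - c by rewrite subr_gt0.
have /filter_ex[k [ak]] : \forall k \near \oo,
    (a%:E < h (u k))%E /\ (h (u k) <= (c + (a - c))%:E)%E.
  by apply: filterI => //; exact: lsc_near ul al.
by rewrite subrKC => /(lt_le_trans ak); rewrite ltxx.
Qed.

End Topology.

(** * Strongly convex functions *)

Section StrongConvexity.
Context {R : realType} {n : nat}.
Implicit Types (g h : 'cV[R]_n -> \bar R) (q : 'cV[R]_n -> R).

(** Quantifying over upper bounds of the two values, instead of the values
    themselves, restricts the inequality to the effective domain and keeps it
    free of infinite operands. *)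
Definition strongly_convex (mu : R) h : Prop :=
  forall (x y : 'cV[R]_n) (a c t : R), 0 < t < 1 ->
    (h x <= a%:E)%E -> (h y <= c%:E)%E ->
    (h (t *: x + (1 - t) *: y)%R <=
      (t * a + (1 - t) * c - mu / 2 * t * (1 - t) * enorm (x - y) ^+ 2)%:E)%E.

Lemma eproper_fin h x (c : R) :
  eproper h -> (h x <= c%:E)%E -> h x = (fine (h x))%:E.
Proof. by move=> [+ _] => /(_ x); case: (h x). Qed.

Lemma strongly_convex1P h :
  eproper h -> strongly_convex1 h -> strongly_convex 1 h.
Proof.
move=> hp hc x y a c t t01 xa yc.
have := hc x y t t01.
have xE := eproper_fin hp xa; have yE := eproper_fin hp yc.
rewrite xE lee_fin in xa; rewrite yE lee_fin in yc.
rewrite xE yE -!EFinB -!EFinM -EFinD leeBlDr // -EFinD.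
move/le_trans; apply; rewrite lee_fin !enorm_sqr !dotE (dotC y x).
have [t0 t1] := andP t01.
have : t * fine (h x) <= t * a by rewrite ler_wpM2l // ltW.
have : (1 - t) * fine (h y) <= (1 - t) * c by rewrite ler_wpM2l // subr_ge0 ltW.
by lra.
Qed.

Lemma le_affine (t q a : R) (v : \bar R) : 0 < t ->
  (t%:E * v + q%:E <= a%:E)%E = (v <= ((a - q) / t)%:E)%E.
Proof.
case: v => [r||] t0; last 2 first.
- by rewrite gt0_muley ?lte_fin // addye.
- by rewrite gt0_muleNy ?lte_fin // addNye !leNye.
by rewrite -EFinM -EFinD !lee_fin ler_pdivlMr // lerBrDr (mulrC t).
Qed.

Lemma strongly_convexD (t mu nu : R) g q : 0 < t ->
  strongly_convex mu g ->
  (forall x y s, 0 < s < 1 -> q (s *: x + (1 - s) *: y) <=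
    s * q x + (1 - s) * q y - nu / 2 * s * (1 - s) * enorm (x - y) ^+ 2) ->
  strongly_convex (t * mu + nu) (fun x => t%:E * g x + (q x)%:E)%E.
Proof.
move=> t0 gc qc x y a c s s01; rewrite !le_affine // => xa yc.
apply: le_trans (gc _ _ _ _ _ s01 xa yc) _.
rewrite lee_fin ler_pdivlMr //; have := qc x y s s01.
set D := enorm _ ^+ 2; set p := q _.
have -> : (s * ((a - q x) / t) + (1 - s) * ((c - q y) / t) -
   mu / 2 * s * (1 - s) * D) * t = s * (a - q x) + (1 - s) * (c - q y) -
   mu / 2 * s * (1 - s) * D * t by field; rewrite gt_eqF.
by lra.
Qed.

(** An affine minorant touching q at x bounds q from below near x, which is all
    that lower semicontinuity of the sum requires of q. *)
Lemma lscD (t : R) g q : 0 < t -> lower_semicontinuous g ->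
  (forall x, exists d, forall y, q x + dot d (y - x) <= q y) ->
  lower_semicontinuous (fun x => t%:E * g x + (q x)%:E)%E.
Proof.
move=> t0 /lsc_enormP gl qd; apply/lsc_enormP => x a.
rewrite ltNge le_affine // -ltNge => ax.
have [a' aa' a'x] := ereal_between ax.
have [r r0 gr] := gl _ _ a'x; have [d dq] := qd x.
pose eta := t * a' - (a - q x).
have eta0 : 0 < eta by rewrite subr_gt0 mulrC -ltr_pdivrMr.
have d0 : 0 < enorm d + 1 by rewrite ltr_wpDl // enorm_ge0.
exists (Num.min r (eta / (enorm d + 1))); first by rewrite lt_min r0 divr_gt0.
move=> y; rewrite lt_min ltr_pdivlMr // => /andP[/gr yr yd].
rewrite ltNge le_affine // -ltNge; apply: le_lt_trans yr.
rewrite lee_fin ler_pdivrMr //.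
have := dot_le_enorm (- d) (y - x); rewrite dotNl enormN.
have := dq y; have := enorm_ge0 (y - x); rewrite /eta in yd.
by rewrite mulrDr mulr1 (mulrC (enorm (y - x))) in yd; lra.
Qed.

Lemma argmin_fin h p : eproper h -> argmin setT h p -> h p = (fine (h p))%:E.
Proof. by move=> [+ _] [_ + _] => /(_ p); case: (h p). Qed.

(** Quadratic growth away from a minimizer: compare the minimizer p with the
    points of the segment from p to y that are close to p. *)
Lemma argmin_growth (mu : R) h p y (c : R) :
  eproper h -> 0 < mu -> strongly_convex mu h -> argmin setT h p ->
  (h y <= c%:E)%E -> fine (h p) + mu / 2 * enorm (y - p) ^+ 2 <= c.
Proof.
move=> hp mu0 hc pmin yc; have pE := argmin_fin hp pmin.
have [_ _ pm] := pmin; set v := fine (h p); rewrite -/v in pE.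
have vc : v <= c by rewrite -lee_fin -pE (le_trans (pm y _)).
rewrite leNgt; apply/negP; set D := enorm _ ^+ 2 => cv.
pose w := v + mu / 2 * D - c.
have w0 : 0 < w by rewrite subr_gt0.
have D0 : 0 < mu * D by rewrite /w in w0; lra.
(* with this t the second-order loss is half of the assumed violation w *)
pose t := w / (mu * D).
have tE : t * (mu * D) = w by rewrite /t divfK // gt_eqF.
have t0 : 0 < t by rewrite divr_gt0.
have t1 : t < 1 by rewrite ltr_pdivrMr // /w; lra.
have := hc y p c v t; rewrite t0 t1 yc pE lexx.
move=> /(_ isT isT isT) /(le_trans (pm _ I)).
rewrite pE lee_fin -/D => vle.
have : 0 <= t * (c - v - mu / 2 * D + w / 2).
  by rewrite -tE; lra.
by rewrite pmulr_rge0 // /w; lra.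
Qed.

(** A lower semicontinuous strongly convex function cannot escape to minus
    infinity: it is bounded below on a small ball around a point of its domain,
    and outside of that ball convexity along the segment to the centre turns
    this local bound into a coercive global one. *)
Lemma strongly_convex_lbound (mu : R) h :
  eproper h -> 0 < mu -> strongly_convex mu h -> lower_semicontinuous h ->
  exists M : R, forall y (c : R), (h y <= c%:E)%E -> M <= c.
Proof.
move=> hp mu0 hc /lsc_enormP hl; have [_ [x0 x0y]] := hp.
have x0E : h x0 = (fine (h x0))%:E.
  by case: hp => + _ => /(_ x0); case: (h x0) x0y.
set h0 := fine _ in x0E.
have [r r0 hr] := hl x0 (h0 - 1) ltac:(by rewrite x0E lte_fin ltrBlDr ltrDl).
(* - 4 / (mu * r ^+ 2) is the minimum over d of mu / 4 * d ^+ 2 - 2 * d / r *)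
exists (h0 - 1 - 4 / (mu * r ^+ 2)) => y c yc.
have B0 : 0 < 4 / (mu * r ^+ 2) by rewrite divr_gt0 // mulr_gt0 ?exprn_gt0.
have [yr|ry] := ltP (enorm (y - x0)) r.
  by have := lt_le_trans (hr _ yr) yc; rewrite lte_fin; lra.
set d := enorm _ in ry; have d0 : 0 < d := lt_le_trans r0 ry.
(* weight of y in the point of the segment at distance r / 2 from x0 *)
pose t := r / (2 * d).
have tE : t * d = r / 2 by rewrite /t; field; rewrite gt_eqF.
have t0 : 0 < t by rewrite divr_gt0 // mulr_gt0.
have t2 : t <= 2^-1.
  by rewrite -(ler_pM2r d0) tE; lra.
have t1 : t < 1 by lra.
have := hc y x0 c h0 t; rewrite t0 t1 yc x0E lexx => /(_ isT isT isT).
have /hr /lt_le_trans /[apply] : enorm (t *: y + (1 - t) *: x0 - x0) < r.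
  have -> : t *: y + (1 - t) *: x0 - x0 = t *: (y - x0).
    by apply/matrixP => i j; rewrite !mxE; ring.
  by rewrite enormZ gtr0_norm // tE; lra.
have -> : enorm (y - x0) = d by [].
rewrite lte_fin => hlt.
have w0 : 0 < 2 * d / r by rewrite divr_gt0 // mulr_gt0.
have tw : t * (2 * d / r) = 1 by rewrite /t; field; rewrite !gt_eqF.
have : 0 < (t * (c - h0) + 1 - mu / 2 * t * (1 - t) * d ^+ 2) * (2 * d / r).
  by rewrite mulr_gt0 //; lra.
have -> : (t * (c - h0) + 1 - mu / 2 * t * (1 - t) * d ^+ 2) * (2 * d / r) =
  t * (2 * d / r) * (c - h0 - mu / 2 * (1 - t) * d ^+ 2) + 2 * d / r by ring.
have : 0 <= mu * d ^+ 2 * (2^-1 - t).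
  by rewrite mulr_ge0 ?subr_ge0 // mulr_ge0 ?sqr_ge0 // ltW.
have : 0 <= mu / 4 * d ^+ 2 + 4 / (mu * r ^+ 2) - 2 * d / r.
  have -> : mu / 4 * d ^+ 2 + 4 / (mu * r ^+ 2) - 2 * d / r =
    (mu * r * d - 4) ^+ 2 / (4 * (mu * r ^+ 2)) by field; rewrite !gt_eqF.
  by rewrite divr_ge0 ?sqr_ge0 // mulr_ge0 // mulr_ge0 ?sqr_ge0 // ltW.
by rewrite tw; lra.
Qed.

(** Minimizing sequences are Cauchy, because the value at the midpoint of two
    of their terms cannot undercut the infimum. *)
Lemma strongly_convex_argmin (mu : R) h :
  eproper h -> 0 < mu -> strongly_convex mu h -> lower_semicontinuous h ->
  exists p, argmin setT h p.
Proof.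
move=> hp mu0 hc hl.
have [M hM] := strongly_convex_lbound hp mu0 hc hl.
pose V := [set c : R | exists y, (h y <= c%:E)%E].
have V0 : has_inf V.
  split; last by exists M => c [y]; exact: hM.
  have [hNy [x0 x0y]] := hp; exists (fine (h x0)), x0.
  by have := hNy x0; case: (h x0) x0y.
have hI y (c : R) : (h y <= c%:E)%E -> inf V <= c.
  by move=> yc; apply: ge_inf; [exact: V0.2|exists y].
pose e k : R := k.+1%:R^-1.
have e0 k : 0 < e k by rewrite invr_gt0.
have /choice[u hu] : forall k, exists y, (h y <= (inf V + e k)%:E)%E.
  move=> k; have [c [y yc] cI] := inf_adherent (e0 k) V0.
  by exists y; rewrite (le_trans yc) // lee_fin ltW.
have ecvg : e @ \oo --> 0 by exact: cvg_harmonic.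
have [l ul] : exists l : 'cV[R]_n, u @ \oo --> l.
  apply: (@enorm_cauchy_cvg _ _ _ (fun k => 8 / mu * e k)) => [k j kj|].
    have half : 0 < (2^-1 : R) < 1 by lra.
    have /hI := hc (u j) (u k) _ _ _ half (hu j) (hu k).
    have : e j <= e k by rewrite lef_pV2 ?posrE // ler_nat.
    set D := enorm _ ^+ 2 => ejk Dle.
    rewrite mulrAC ler_pdivlMr //; lra.
  by rewrite -[0](mulr0 (8 / mu)); apply: cvgMr.
have lI : (h l <= (inf V)%:E)%E.
  apply: (lsc_le_lim hl ul) => d d0.
  have : \forall k \near \oo, `|0 - e k| < d by move/cvgrPdist_lt : ecvg; exact.
  apply: filterS => k.
  rewrite sub0r normrN gtr0_norm // => ekd.
  by apply: le_trans (hu k) _; rewrite lee_fin lerD2l ltW.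
exists l; split=> [//||y _]; first exact: le_lt_trans lI (ltry _).
apply: le_trans lI _; have [hNy _] := hp.
have := hNy y; have := hI y; case: (h y) => [r||//]; last by rewrite leey.
by move=> /(_ r (lexx _)); rewrite lee_fin.
Qed.

Lemma minimizer_argmin (mu : R) h :
  eproper h -> 0 < mu -> strongly_convex mu h -> lower_semicontinuous h ->
  argmin setT h (minimizer h).
Proof.
by move=> hp mu0 hc hl; exact: (xgetPex 0 (strongly_convex_argmin hp mu0 hc hl)).
Qed.

End StrongConvexity.

(** * Least squares, the proximal step and the penalized problems *)

Section LeastSquaresTheory.
Context {R : realType} {m n : nat}.
Variables (A : 'M[R]_(m, n)) (b : 'cV[R]_m).
Implicit Types (x y : 'cV[R]_n).

(** The work is to bound the set whose supremum defines the operator norm;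
    homogeneity does the rest. *)
Lemma enorm_mulmx_le x : enorm (A *m x) <= opnorm A * enorm x.
Proof.
pose C : R := m%:R * \sum_i \sum_j `|A i j|.
have AC y : enorm (A *m y) <= C * enorm y.
  apply: le_trans (enorm_le_norm _) _; rewrite /C -mulrA ler_wpM2l //.
  have [->|Ay0] := eqVneq `|A *m y| 0.
    by rewrite mulr_ge0 ?enorm_ge0 // sumr_ge0 // => i _; rewrite sumr_ge0.
  have [[i j] Ayij] := mx_norm_neq0 Ay0.
  rewrite -[leLHS]/(mx_norm (A *m y)) Ayij /= ord1 mxE.
  apply: le_trans (ler_norm_sum _ _ _) _.
  rewrite (bigD1 i) //= mulrDl ler_wpDr //.
    by rewrite mulr_ge0 ?enorm_ge0 // sumr_ge0 // => k _; rewrite sumr_ge0.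
  rewrite mulr_suml ler_sum // => k _; rewrite normrM ler_wpM2l //.
  apply: le_trans (norm_le_enorm _); rewrite -[leRHS]/(mx_norm y) mx_normrE.
  exact: (le_bigmax _ _ (k, 0)).
have [x0|x0] := eqVneq (enorm x) 0.
  by have := AC x; rewrite x0 !mulr0.
have xgt0 : 0 < enorm x by rewrite lt_def x0 enorm_ge0.
rewrite -ler_pdivrMr //; apply: ub_le_sup.
  exists C => _ [y /= y1 <-]; apply: le_trans (AC y) _.
  rewrite ler_piMr // mulr_ge0 // sumr_ge0 // => i _.
  by rewrite sumr_ge0.
exists ((enorm x)^-1 *: x) => /=.
  by rewrite enormZ ger0_norm ?invr_ge0 ?enorm_ge0 // mulVf.
by rewrite -scalemxAr enormZ ger0_norm ?invr_ge0 ?enorm_ge0 // mulrC.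
Qed.

Lemma lsqE x y : lsq A b y =
  lsq A b x + dot (lsq_grad A b x) (y - x) + enorm (A *m (y - x)) ^+ 2 / 2.
Proof.
rewrite /lsq /lsq_grad (dotC (A^T *m _)) -dot_mulmxl.
have -> : A *m y - b = (A *m x - b) + A *m (y - x).
  by rewrite mulmxBr; apply/matrixP => i j; rewrite !mxE; ring.
move: (A *m x - b) (A *m (y - x)) => r d.
by rewrite !enorm_sqr !dotE (dotC d r); lra.
Qed.

Lemma lsq_segment x y (s : R) :
  lsq A b (s *: x + (1 - s) *: y) = s * lsq A b x + (1 - s) * lsq A b y -
    s * (1 - s) * (enorm (A *m (x - y)) ^+ 2 / 2).
Proof.
rewrite /lsq.
have -> : A *m (s *: x + (1 - s) *: y) - b =
    s *: (A *m x - b) + (1 - s) *: (A *m y - b).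
  rewrite mulmxDr -!scalemxAr.
  by apply/matrixP => i j; rewrite !mxE; ring.
have -> : A *m (x - y) = (A *m x - b) - (A *m y - b).
  by rewrite mulmxBr; apply/matrixP => i j; rewrite !mxE; ring.
move: (A *m x - b) (A *m y - b) => u v.
by rewrite !enorm_sqr !dotE (dotC v u); field.
Qed.

Section Argmin.
Variable (xb : 'cV[R]_n).
Hypothesis xb_argmin : lsq_argmin A b xb.

Lemma lsq_min_argmin : lsq_min A b = lsq A b xb.
Proof.
have [_ _ xbmin] := xb_argmin.
apply/eqP; rewrite eq_le; apply/andP; split.
  by apply: ge_inf; [exists (lsq A b xb) => _ [y _ <-]|exists xb];
    rewrite // -lee_fin xbmin.
apply: lb_le_inf; first by exists (lsq A b xb), xb.
by move=> _ [y _ <-]; rewrite -lee_fin xbmin.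
Qed.

(** Fermat's rule, from a short step along the opposite of the gradient. *)
Lemma lsq_grad_argmin : lsq_grad A b xb = 0.
Proof.
have [_ _ xbmin] := xb_argmin; apply: dot_eq0.
set d := lsq_grad A b xb; apply/eqP; rewrite eq_le dot_ge0 andbT leNgt.
apply/negP => d0; set e := enorm (A *m d) ^+ 2.
have e0 : 0 <= e by exact: sqr_ge0.
(* minimizer over t of the upper bound - t |d|^2 + t^2 (|A d|^2 + 1) / 2 *)
pose t := dot d d / (e + 1).
have := xbmin (xb - t *: d) I; rewrite lee_fin (lsqE xb (xb - t *: d)).
have -> : xb - t *: d - xb = (- t) *: d by rewrite addrC addKr scaleNr.
rewrite -/d -scalemxAr enormZ exprMn normrN real_normK ?num_real // -/e dotZr.
have tE : t * (e + 1) = dot d d by rewrite divfK // gt_eqF // ltr_wpDl.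
have t0 : 0 < t by rewrite divr_gt0 // ltr_wpDl.
have : 0 < t ^+ 2 * (e / 2 + 1).
  by rewrite mulr_gt0 ?exprn_gt0 // ltr_wpDl // divr_ge0.
by rewrite -tE; lra.
Qed.

Lemma lsqB_min x : lsq A b x - lsq_min A b = enorm (A *m (x - xb)) ^+ 2 / 2.
Proof.
by rewrite lsq_min_argmin (lsqE xb x) lsq_grad_argmin dot0l; ring.
Qed.

Lemma lsq_argminP x : lsq_argmin A b x <-> A *m (x - xb) = 0.
Proof.
have [_ _ xbmin] := xb_argmin; split=> [[_ _ xmin]|Ax0].
  apply: dot_eq0; rewrite -enorm_sqr; apply/eqP.
  rewrite eq_le sqr_ge0 andbT.
  have := lsqB_min x; have := xmin xb I.
  by rewrite lsq_min_argmin lee_fin; lra.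
have fx : lsq A b x = lsq A b xb.
  have := lsqB_min x; rewrite Ax0 lsq_min_argmin enorm_sqr dot0l mul0r.
  by move/eqP; rewrite subr_eq0 => /eqP.
by split=> [//||y _]; rewrite ?ltry // fx xbmin.
Qed.

Lemma lsq_gradE x : lsq_grad A b x = A^T *m (A *m (x - xb)).
Proof.
have -> : A *m (x - xb) = (A *m x - b) - (A *m xb - b).
  by rewrite mulmxBr; apply/matrixP => i j; rewrite !mxE; ring.
by rewrite mulmxBr -/(lsq_grad A b xb) lsq_grad_argmin subr0.
Qed.

End Argmin.
End LeastSquaresTheory.

Section Regularized.
Context {R : realType} {n : nat}.
Variable g : 'cV[R]_n -> \bar R.
Hypotheses (g_proper : eproper g) (g_lsc : lower_semicontinuous g).
Hypothesis g_sc : strongly_convex 1 g.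

Lemma eproperD (t : R) (q : 'cV[R]_n -> R) : 0 < t ->
  eproper (fun x => t%:E * g x + (q x)%:E)%E.
Proof.
move=> t0; have [gNy [x0 x0y]] := g_proper; split=> [x|].
  have := gNy x; case: (g x) => [r||//] _.
    by rewrite -EFinM -EFinD.
  by rewrite gt0_muley ?lte_fin.
exists x0; have := gNy x0; case: (g x0) x0y => [r||//] _ _ //.
by rewrite -EFinM -EFinD ltry.
Qed.

(** The quadratic growth of the proximal objective at its minimizer, with
    modulus tau + 1, says that (w - p) / tau is a subgradient of g at p, the
    term |y - p|^2 / 2 being what is left of the modulus. *)
Lemma prox_subgrad (tau : R) w y (c : R) : 0 < tau ->
  let p := prox tau g w in
  (g p < +oo)%E /\
  ((g y <= c%:E)%E ->
   fine (g p) + tau^-1 * dot (w - p) (y - p) + enorm (y - p) ^+ 2 / 2 <= c).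
Proof.
move=> t0 p; pose q x := lsq 1%:M w x.
pose h := fun x => (tau%:E * g x + (q x)%:E)%E.
have pE : p = minimizer h.
  rewrite /p /prox; congr minimizer.
  by apply/funext => x; rewrite /h /q /lsq mul1mx.
have hp : eproper h by exact: eproperD.
have mu0 : 0 < tau * 1 + 1 by lra.
have hc : strongly_convex (tau * 1 + 1) h.
  apply: strongly_convexD => // x z s /andP[s0 s1].
  by rewrite /q lsq_segment mul1mx; lra.
have hl : lower_semicontinuous h.
  apply: lscD => // x; exists (lsq_grad 1%:M w x) => z.
  by rewrite /q (lsqE _ _ x z) lerDl divr_ge0 ?sqr_ge0.
have pmin := minimizer_argmin hp mu0 hc hl; rewrite -pE in pmin.
have hpE := argmin_fin hp pmin.
have gpE : g p = (fine (g p))%:E.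
  have : (h p <= (fine (h p))%:E)%E by rewrite -hpE.
  by rewrite le_affine //; exact: eproper_fin.
split=> [|yc]; first by rewrite gpE ltry.
have hyc : (h y <= (tau * c + q y)%:E)%E.
  by rewrite le_affine // addrK mulrAC divff ?gt_eqF // mul1r.
have := argmin_growth hp mu0 hc pmin hyc.
have -> : fine (h p) = tau * fine (g p) + q p by rewrite /h gpE.
rewrite /q (lsqE _ _ p y) /lsq_grad trmx1 !mul1mx => le_c.
rewrite -(ler_pM2l t0) !mulrDr mulrA divff ?gt_eqF // mul1r.
have -> : w - p = - (p - w) by rewrite opprB.
by rewrite dotNl; lra.
Qed.

Section Penalized.
Context {m : nat}.
Variables (A : 'M[R]_(m, n)) (b : 'cV[R]_m) (c : R).
Hypothesis c_ge0 : 0 <= c.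

Lemma penalizedE : penalized A b g c =
  (fun x => 1%:E * g x + (c * (lsq A b x - lsq_min A b))%:E)%E.
Proof. by apply/funext => x; rewrite mul1e. Qed.

Lemma penalized_proper : eproper (penalized A b g c).
Proof. by rewrite penalizedE; exact: eproperD. Qed.

Lemma penalized_strongly_convex : strongly_convex 1 (penalized A b g c).
Proof.
rewrite penalizedE -[X in strongly_convex X](addr0 1) -[X in X + 0](mulr1 1).
apply: strongly_convexD => // x y s /andP[s0 s1]; rewrite lsq_segment.
have : 0 <= c * (s * (1 - s) * (enorm (A *m (x - y)) ^+ 2 / 2)).
  rewrite mulr_ge0 // mulr_ge0 ?divr_ge0 ?sqr_ge0 // mulr_ge0 ?(ltW s0) //.
  by rewrite subr_ge0 ltW.
by lra.
Qed.

Lemma penalized_lsc : lower_semicontinuous (penalized A b g c).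
Proof.
rewrite penalizedE; apply: lscD => // x; exists (c *: lsq_grad A b x) => y.
rewrite dotZl (lsqE _ _ x y).
have : 0 <= c * (enorm (A *m (y - x)) ^+ 2 / 2).
  by rewrite mulr_ge0 // divr_ge0 ?sqr_ge0.
by lra.
Qed.

Lemma penalized_argmin :
  argmin setT (penalized A b g c) (minimizer (penalized A b g c)).
Proof.
exact: minimizer_argmin penalized_proper ltr01 penalized_strongly_convex
  penalized_lsc.
Qed.

End Penalized.
End Regularized.

(** * Step sizes *)

Section StepSizes.
Context {R : realType}.
Variables (lambda : R) (tau sigma : nat -> R).
Hypotheses (lambda_gt0 : 0 < lambda) (tau0_gt0 : 0 < tau 0%N).
Hypothesis tauE : forall k, tau k.+1 = tau k / Num.sqrt (1 + tau k).
Hypothesis sigmaE : forall k, sigma k = lambda / tau k.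

Lemma tau_gt0 k : 0 < tau k.
Proof.
elim: k => [//|k IH]; rewrite tauE divr_gt0 // sqrtr_gt0.
by rewrite addr_gt0.
Qed.

Lemma sigma_gt0 k : 0 < sigma k.
Proof. by rewrite sigmaE divr_gt0 // tau_gt0. Qed.

Lemma tauV k : (tau k)^-1 = sigma k / lambda.
Proof. by rewrite sigmaE mulrAC divff ?mul1r // gt_eqF. Qed.

(** The rule for tau is chosen for this identity: lambda * sigma k is the gain
    that strong convexity of g brings to the weight of the squared distance to
    the solution in one step. *)
Lemma sigma_sqrS k : sigma k.+1 ^+ 2 = sigma k ^+ 2 + lambda * sigma k.
Proof.
have t0 := tau_gt0 k; have t1 : 0 < 1 + tau k by rewrite addr_gt0.
rewrite !sigmaE tauE !exprMn !exprVn exprMn exprVn sqr_sqrtr ?ltW //.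
by field; rewrite !gt_eqF.
Qed.

Lemma sigma_leS k : sigma k <= sigma k.+1.
Proof.
rewrite -ler_sqr ?nnegrE ?(ltW (sigma_gt0 _)) // sigma_sqrS lerDl.
by rewrite mulr_ge0 ?(ltW (sigma_gt0 _)) // ltW.
Qed.

(** As soon as d <= lambda / 4 and d <= sigma k, the square of sigma k + d is at
    most sigma k ^+ 2 + lambda * sigma k, so sigma grows by at least d at each
    step. *)
Lemma sigma_ge_linear : exists2 c, 0 < c & forall k, c * k.+1%:R <= sigma k.
Proof.
have s0 := sigma_gt0 0.
pose d := Num.min (lambda / 4) (sigma 0%N).
have d0 : 0 < d by rewrite lt_min s0 divr_gt0.
have dl : d <= lambda / 4 by rewrite ge_min lexx.
have ds : d <= sigma 0%N by rewrite ge_min lexx orbT.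
exists d => //; elim=> [|k IH]; first by rewrite mulr1.
have sk := sigma_gt0 k.
have dk : d <= sigma k.
  by apply: le_trans IH; rewrite ler_peMr ?(ltW d0) // ler1n.
have : sigma k + d <= sigma k.+1.
  rewrite -ler_sqr ?nnegrE ?addr_ge0 ?(ltW (sigma_gt0 _)) ?(ltW d0) // sigma_sqrS.
  have : d * sigma k <= lambda / 4 * sigma k by rewrite ler_wpM2r // ltW.
  have : d * d <= d * sigma k by rewrite ler_wpM2l // ltW.
  have : 0 < lambda * sigma k by rewrite mulr_gt0.
  by lra.
by rewrite -natr1 mulrDr mulr1; lra.
Qed.

Section Sums.
Variable c : R.
Hypotheses (c_gt0 : 0 < c) (sigma_ge : forall k, c * k.+1%:R <= sigma k).

Lemma series_sigma_ge k : c / 2 * k%:R ^+ 2 <= series sigma k.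
Proof.
elim: k => [|k IH]; first by rewrite expr0n mulr0 /series /= big_nil.
rewrite seriesS; have := sigma_ge k; rewrite -[k.+1%:R]natr1.
by have := c_gt0; lra.
Qed.

Lemma series_sigma_gt0 k : 0 < series sigma k.+1.
Proof.
apply: lt_le_trans (series_sigma_ge _).
by rewrite mulr_gt0 ?divr_gt0 // exprn_gt0.
Qed.

Lemma series_sigma_sqr_ge k :
  c ^+ 2 / 3 * k%:R ^+ 3 <= series (fun j => sigma j ^+ 2) k.
Proof.
elim: k => [|k IH]; first by rewrite expr0n mulr0 /series /= big_nil.
rewrite seriesS.
have : (c * k.+1%:R) ^+ 2 <= sigma k ^+ 2.
  by rewrite ler_sqr ?nnegrE ?(ltW (sigma_gt0 _)) // mulr_ge0 ?ltW.
rewrite -[k.+1%:R]natr1; have : 0 <= c ^+ 2 * k%:R by rewrite mulr_ge0 ?sqr_ge0.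
have : 0 <= c ^+ 2 by exact: sqr_ge0.
by lra.
Qed.

End Sums.
End StepSizes.

(** * Energy estimates *)

Section Energy.
Context {R : realType} {m n : nat}.
Variables (A : 'M[R]_(m, n)) (lambda : R) (sigma : nat -> R).
Hypotheses (lambda_gt0 : 0 < lambda) (lambda_le : lambda * opnorm A ^+ 2 <= 1).
Hypothesis sigma_gt0 : forall k, 0 < sigma k.
Hypothesis sigma_sqrS :
  forall k, sigma k.+1 ^+ 2 = sigma k ^+ 2 + lambda * sigma k.
Hypothesis sigma_leS : forall k, sigma k <= sigma k.+1.

(** The quadratic form of I / lambda - A^T A, which the condition on lambda
    makes positive semidefinite. *)
Definition step_norm2 (d : 'cV[R]_n) : R :=
  dot d d / lambda - dot (A *m d) (A *m d).

Lemma step_norm2_ge0 d : 0 <= step_norm2 d.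
Proof.
rewrite /step_norm2 subr_ge0 ler_pdivlMr // -!enorm_sqr.
have : enorm (A *m d) ^+ 2 <= (opnorm A * enorm d) ^+ 2.
  rewrite ler_sqr ?nnegrE ?enorm_ge0 ?enorm_mulmx_le //.
  exact: le_trans (enorm_ge0 _) (enorm_mulmx_le _ _).
rewrite exprMn; set a := enorm _ ^+ 2; set o := _ ^+ 2; set e := _ ^+ 2 => aoe.
have : a * lambda <= o * e * lambda by rewrite ler_wpM2r // ltW.
have : lambda * o * e <= 1 * e by rewrite ler_wpM2r ?sqr_ge0.
by lra.
Qed.

Lemma step_norm2_cross d d' :
  2 * (dot d d' / lambda - dot (A *m d) (A *m d')) <=
  step_norm2 d + step_norm2 d'.
Proof.
have := step_norm2_ge0 (d - d').
by rewrite /step_norm2 mulmxBr !dotE (dotC d' d) (dotC (A *m d')); lra.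
Qed.

(** X k stands for x k - xbar, S k for the sum of the weights times s k - xbar,
    and G k for the gap of g at x k.+1; the algorithm enters only through the
    recursion for S and the subgradient inequalities below. *)
Variables (X S : nat -> 'cV[R]_n) (G : nat -> R).
Hypotheses (S0 : S 0%N = 0) (SS : forall k, S k.+1 = S k + sigma k *: X k.+1).

(** The subgradient of g at x k.+1 that the proximal step produces. *)
Definition step_subgrad k : 'cV[R]_n :=
  (sigma k / lambda) *: (X k - X k.+1) - A^T *m (A *m (S k + sigma k *: X k)).

Lemma dot_step_subgrad k d : dot (step_subgrad k) d =
  sigma k / lambda * (dot (X k) d - dot (X k.+1) d) -
  (dot (A *m S k) (A *m d) + sigma k * dot (A *m X k) (A *m d)).
Proof.
rewrite /step_subgrad !dotE; congr (_ - _).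
by rewrite dotC -dot_mulmxl dotC mulmxDr -scalemxAr !dotE.
Qed.

Hypothesis G_le0 : forall k,
  G k + dot (step_subgrad k) (- X k.+1) + dot (X k.+1) (X k.+1) / 2 <= 0.

(** Testing the subgradient at the solution, polarization turns the product of
    A *m (S k + sigma k *: X k) and sigma k *: A *m X k.+1 into the increment of
    |A S|^2 / 2, a term in |A X k|^2 and the |A d|^2 part of step_norm2. *)
Lemma energy_step k :
  sigma k * G k + dot (A *m S k.+1) (A *m S k.+1) / 2 +
    sigma k.+1 ^+ 2 * (dot (X k.+1) (X k.+1) / (2 * lambda)) +
    sigma k ^+ 2 / 2 *
      (dot (A *m X k) (A *m X k) + step_norm2 (X k.+1 - X k)) <=
  dot (A *m S k) (A *m S k) / 2 +
    sigma k ^+ 2 * (dot (X k) (X k) / (2 * lambda)).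
Proof.
have := G_le0 k; rewrite dot_step_subgrad -(ler_pM2l (sigma_gt0 k)) mulr0.
rewrite SS /step_norm2 sigma_sqrS mulmxN !mulmxBr mulmxDr -scalemxAr.
have -> : (sigma k ^+ 2 + lambda * sigma k) *
    (dot (X k.+1) (X k.+1) / (2 * lambda)) =
  sigma k ^+ 2 * dot (X k.+1) (X k.+1) / 2 / lambda +
    sigma k * dot (X k.+1) (X k.+1) / 2 by field; rewrite gt_eqF.
rewrite invfM !dotE (dotC (X k.+1) (X k)) (dotC (A *m X k.+1) (A *m X k)).
rewrite (dotC (A *m X k.+1) (A *m S k)).
by lra.
Qed.

Definition dissipation k : R :=
  sigma k ^+ 2 * (dot (A *m X k) (A *m X k) + step_norm2 (X k.+1 - X k)).

Lemma energy_sum k :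
  series (fun j => sigma j * G j) k + dot (A *m S k) (A *m S k) / 2 +
    sigma k ^+ 2 * (dot (X k) (X k) / (2 * lambda)) +
    series dissipation k / 2 <=
  sigma 0%N ^+ 2 * (dot (X 0%N) (X 0%N) / (2 * lambda)).
Proof.
elim: k => [|k IH].
  by rewrite S0 mulmx0 dot0l /series /= !big_nil; lra.
by have := energy_step k; rewrite !seriesS /dissipation; lra.
Qed.

Lemma dissipation_ge0 k : 0 <= dissipation k.
Proof. by rewrite mulr_ge0 ?sqr_ge0 // addr_ge0 ?dot_ge0 ?step_norm2_ge0. Qed.

Lemma series_dissipation_ge0 k : 0 <= series dissipation k.
Proof. by apply: sumr_ge0 => j _; exact: dissipation_ge0. Qed.

(** The subgradient inequalities of two consecutive steps, each tested at the
    point of the other. *)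
Hypothesis G_monotone : forall k,
  G k.+1 + dot (step_subgrad k.+1) (X k.+1 - X k.+2) +
    dot (X k.+1 - X k.+2) (X k.+1 - X k.+2) / 2 <= G k /\
  G k + dot (step_subgrad k) (X k.+2 - X k.+1) +
    dot (X k.+2 - X k.+1) (X k.+2 - X k.+1) / 2 <= G k.+1.

Definition residual k : R :=
  dot (A *m X k.+1) (A *m X k.+1) + step_norm2 (X k.+1 - X k).

(** Adding the two inequalities of G_monotone, the difference of consecutive
    subgradients only involves the last two increments and A *m X k.+1; the
    product of the increments is split by the Cauchy-Schwarz inequality for
    step_norm2, and sigma k <= sigma k.+1 absorbs the change of weight. *)
Lemma residual_nincr k : residual k.+1 <= residual k.
Proof.
have [h1 h2] := G_monotone k.
pose d1 := X k.+1 - X k; pose d2 := X k.+2 - X k.+1.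
have key : dot d2 d2 + sigma k.+1 / 2 * (2 * dot d2 d2 / lambda +
    dot (A *m X k.+2) (A *m X k.+2) - dot (A *m X k.+1) (A *m X k.+1) -
    dot (A *m d2) (A *m d2)) <=
    sigma k * (dot d1 d2 / lambda - dot (A *m d1) (A *m d2)).
  move: h1 h2; rewrite !dot_step_subgrad SS /d1 /d2 !mulmxDr !mulmxN -scalemxAr.
  move: (X k) (X k.+1) (X k.+2) => u v w.
  move: (A *m u) (A *m v) (A *m w) (A *m S k) => Au Av Aw AS.
  by rewrite !dotE (dotC w v) (dotC Aw Av); lra.
have cross := step_norm2_cross d1 d2.
have p1 := step_norm2_ge0 d1; have p2 := step_norm2_ge0 d2.
have N1 := dot_ge0 d2; have N2 := dot_ge0 (A *m d2).
rewrite /residual -/d1 -/d2.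
have : sigma k * (2 * (dot d1 d2 / lambda - dot (A *m d1) (A *m d2))) <=
    sigma k * (step_norm2 d1 + step_norm2 d2).
  by rewrite ler_pM2l.
have : sigma k * (step_norm2 d1 + step_norm2 d2) <=
    sigma k.+1 * (step_norm2 d1 + step_norm2 d2).
  by rewrite ler_wpM2r // addr_ge0.
move=> c1 c2; have : sigma k.+1 * (2 * dot d2 d2 / lambda +
    dot (A *m X k.+2) (A *m X k.+2) - dot (A *m X k.+1) (A *m X k.+1) -
    dot (A *m d2) (A *m d2)) <= sigma k.+1 * (step_norm2 d1 + step_norm2 d2).
  by lra.
by rewrite ler_pM2l // /step_norm2; lra.
Qed.

Lemma residual_nincrn j k : (j <= k)%N -> residual k <= residual j.
Proof.
move=> /subnK <-; elim: (k - j)%N => [//|i IH].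
exact: le_trans (residual_nincr _) IH.
Qed.

(** Since the residual is nonincreasing, its value at k times the sum of the
    weights sigma j ^+ 2 is at most the weighted sum of the residuals, which the
    dissipation bounds after a shift of the index in the terms in A *m X, the
    weights being nondecreasing. *)
Lemma residual_le_dissipation k :
  residual k * series (fun j => sigma j ^+ 2) k.+1 <= series dissipation k.+2.
Proof.
apply: (@le_trans _ _ (series (fun j => sigma j ^+ 2 * residual j) k.+1)).
  rewrite /series /= mulr_sumr; apply: ler_sum_nat => j /andP[_ jk].
  by rewrite mulrC ler_wpM2l ?sqr_ge0 // residual_nincrn.
have : forall i, series (fun j => sigma j ^+ 2 * residual j) i <=
    series dissipation i + sigma i ^+ 2 * dot (A *m X i) (A *m X i).
  elim=> [|i IH].
    by rewrite /series /= !big_nil add0r mulr_ge0 ?sqr_ge0 ?dot_ge0.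
  rewrite !seriesS /dissipation /residual.
  have : 0 <= (sigma i.+1 ^+ 2 - sigma i ^+ 2) *
      dot (A *m X i.+1) (A *m X i.+1).
    by rewrite sigma_sqrS mulr_ge0 ?dot_ge0 // addrAC subrr add0r mulr_ge0 // ltW.
  by lra.
move=> /(_ k.+1)/le_trans; apply; rewrite [leRHS]seriesS addrC lerD2r.
by rewrite ler_wpM2l ?sqr_ge0 // lerDl step_norm2_ge0.
Qed.

(** A multiplier bounds the sum of the gaps G j below by a multiple of the
    norm of A *m S k, which the energy controls quadratically. *)
Lemma energy_multiplier (v : 'cV[R]_m) k :
  (forall j, - dot v (A *m X j.+1) <= G j) ->
  dot (A *m S k) (A *m S k) / 4 +
    sigma k ^+ 2 * (dot (X k) (X k) / (2 * lambda)) +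
    series dissipation k / 2 <=
  sigma 0%N ^+ 2 * (dot (X 0%N) (X 0%N) / (2 * lambda)) + dot v v.
Proof.
move=> Gv; have := energy_sum k.
have : - dot v (A *m S k) <= series (fun j => sigma j * G j) k.
  elim: k => [|k IH].
    by rewrite S0 mulmx0 dotC dot0l oppr0 /series /= big_nil.
  rewrite seriesS SS mulmxDr -scalemxAr !dotE.
  have := Gv k; rewrite -(ler_pM2l (sigma_gt0 k)); lra.
have := dot_ge0 (A *m S k - 2 *: v); rewrite !dotE (dotC _ v).
by lra.
Qed.

End Energy.

(** * Orders of magnitude *)

Section Rates.
Context {R : realType}.

Lemma bigO_natX (u : nat -> R) (p : nat) (C : R) :
  (forall k, (0 < k)%N -> `|u k| <= C / k%:R ^+ p) ->
  u =O_\oo (fun k => (k%:R ^- p : R^o)).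
Proof.
move=> uC; apply/eqO_exP; exists (Num.max 1 C); first by rewrite lt_max ltr01.
exists 1%N => // k /= k0; apply: le_trans (uC k k0) _.
rewrite [`|_ ^- _|]ger0_norm ?invr_ge0 ?exprn_ge0 //.
by rewrite ler_wpM2r ?invr_ge0 ?exprn_ge0 // le_max lexx orbT.
Qed.

Lemma littleo_natX (u : nat -> R) (p : nat) :
  (forall e, 0 < e -> \forall k \near \oo, `|u k| <= e / k%:R ^+ p) ->
  u =o_\oo (fun k => (k%:R ^- p : R^o)).
Proof.
move=> ue; apply/eqoP => e e0; apply: filterS (ue e e0) => k uk.
by rewrite [`|_ ^- _|]ger0_norm ?invr_ge0 ?exprn_ge0.
Qed.

Lemma ebigO_natX (u : nat -> \bar R) (p : nat) (C : R) :
  (forall k, (0 < k)%N ->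
    ((- (C / k%:R ^+ p))%:E <= u k)%E /\ (u k <= (C / k%:R ^+ p)%:E)%E) ->
  ebigO u (fun k => k%:R ^- p).
Proof.
move=> uC; exists C; exists 1%N => // k /= k0; have [ul uu] := uC k k0.
rewrite ger0_norm ?invr_ge0 ?exprn_ge0 //; move: ul uu; case: (u k) => [r||] //.
by rewrite !lee_fin ler_norml => -> ->.
Qed.
End Rates.

Section Convergence.
Context {R : realType} {m n : nat}.
Variables (g : 'cV[R]_n -> \bar R) (A : 'M[R]_(m, n)) (b : 'cV[R]_m).
Variables (xbar : 'cV[R]_n) (lambda : R).
Variables (tau sigma : nat -> R) (x s z : nat -> 'cV[R]_n).
Hypotheses (g_proper : eproper g) (g_lsc : lower_semicontinuous g).
Hypothesis g_sc : strongly_convex 1 g.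
Hypothesis S_eq : solution_set A b g = [set xbar].
Hypotheses (lambda_gt0 : 0 < lambda) (lambda_le : lambda * opnorm A ^+ 2 <= 1).
Hypothesis tau0_gt0 : 0 < tau 0%N.
Hypothesis tauE : forall k, tau k.+1 = tau k / Num.sqrt (1 + tau k).
Hypothesis sigmaE : forall k, sigma k = lambda / tau k.
Hypothesis zE : forall k, z k =
  (series sigma k.+1)^-1 *: (sigma k *: x k + series sigma k *: s k).
Hypothesis xE : forall k, x k.+1 =
  prox (tau k) g (x k - (tau k * series sigma k.+1) *: lsq_grad A b (z k)).
Hypothesis sE : forall k, s k.+1 =
  (series sigma k.+1)^-1 *: (sigma k *: x k.+1 + series sigma k *: s k).

Let gbar := fine (g xbar).
Let F k := penalized A b g (series sigma k).
Let phi y := lsq A b y - lsq_min A b.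

Let xbar_sol : solution_set A b g xbar. Proof. by rewrite S_eq. Qed.

Let xbar_argmin : lsq_argmin A b xbar. Proof. by case: xbar_sol. Qed.

Lemma g_xbar : g xbar = gbar%:E.
Proof.
have [_ xbar_fin _] := xbar_sol; have [/(_ xbar)] := g_proper.
by rewrite /gbar; case: (g xbar) xbar_fin.
Qed.

Lemma optimal_valueE : optimal_value A b g = gbar%:E.
Proof.
have [_ _ xmin] := xbar_sol; apply/eqP; rewrite eq_le -g_xbar; apply/andP; split.
  by apply: ereal_inf_lbound; exists xbar.
by apply: le_ereal_inf_tmp => _ [y yA <-]; exact: xmin.
Qed.

Let phiE y : phi y = dot (A *m (y - xbar)) (A *m (y - xbar)) / 2.
Proof. by rewrite /phi (lsqB_min xbar_argmin) enorm_sqr. Qed.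

Let phi_ge0 y : 0 <= phi y.
Proof. by rewrite phiE divr_ge0 ?dot_ge0. Qed.

Let tau_pos := tau_gt0 tau0_gt0 tauE.
Let sigma_pos : forall k, 0 < sigma k :=
  sigma_gt0 lambda_gt0 tau0_gt0 tauE sigmaE.
Let sigma_rec := sigma_sqrS tau0_gt0 tauE sigmaE.
Let sigma_incr := sigma_leS lambda_gt0 tau0_gt0 tauE sigmaE.

Let series_gt0 k : 0 < series sigma k.+1.
Proof.
by have [c c0 cs] := sigma_ge_linear lambda_gt0 tau0_gt0 tauE sigmaE;
  exact: (series_sigma_gt0 c0 cs).
Qed.

Let series_ge0 k : 0 <= series sigma k.
Proof. by case: k => [|k]; [rewrite /series /= big_nil|exact: ltW]. Qed.

(** ** The iteration in the coordinates of the energy estimates *)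

Let X k := x k - xbar.
Let S k := series sigma k *: (s k - xbar).
Let G k := fine (g (x k.+1)) - gbar.
Let subgrad := step_subgrad A lambda sigma X S.

Let S0 : S 0%N = 0.
Proof. by rewrite /S /series /= big_nil scale0r. Qed.

Let SS k : S k.+1 = S k + sigma k *: X k.+1.
Proof.
rewrite /S /X sE scalerBr scalerA divff ?gt_eqF // scale1r seriesS.
by apply/matrixP => i j; rewrite !mxE; ring.
Qed.

Let subgradE k :
  (tau k)^-1 *:
    (x k - (tau k * series sigma k.+1) *: lsq_grad A b (z k) - x k.+1) =
  subgrad k.
Proof.
have t0 := tau_pos k; rewrite /subgrad /step_subgrad -(tauV lambda_gt0 sigmaE).
have -> : S k + sigma k *: X k = series sigma k.+1 *: (z k - xbar).
  rewrite /S /X zE [RHS]scalerBr scalerA divff ?gt_eqF // scale1r seriesS.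
  by apply/matrixP => i j; rewrite !mxE; ring.
rewrite (lsq_gradE xbar_argmin) -!scalemxAr addrAC scalerBr scalerA.
rewrite mulKf ?gt_eqF //.
congr (_ *: _ - _); rewrite /X; apply/matrixP => i j; rewrite !mxE; ring.
Qed.

Lemma iterate_subgrad k y (c : R) : (g y <= c%:E)%E ->
  fine (g (x k.+1)) + dot (subgrad k) (y - x k.+1) +
    dot (y - x k.+1) (y - x k.+1) / 2 <= c.
Proof.
have [_ h] := prox_subgrad g_proper g_lsc g_sc
  (x k - (tau k * series sigma k.+1) *: lsq_grad A b (z k)) y c (tau_pos k).
by move=> /h; rewrite -xE -dotZl subgradE enorm_sqr.
Qed.

Lemma iterate_fin k : g (x k.+1) = (fine (g (x k.+1)))%:E.
Proof.
have [+ _] := prox_subgrad g_proper g_lsc g_sc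
  (x k - (tau k * series sigma k.+1) *: lsq_grad A b (z k)) 0 0 (tau_pos k).
by rewrite -xE; case: g_proper => + _ => /(_ (x k.+1)); case: (g _).
Qed.

Let G_le0 k :
  G k + dot (subgrad k) (- X k.+1) + dot (X k.+1) (X k.+1) / 2 <= 0.
Proof.
have := @iterate_subgrad k xbar gbar; rewrite g_xbar lexx => /(_ isT).
have -> : xbar - x k.+1 = - X k.+1 by rewrite opprB.
by rewrite dotNl !dotNr opprK /G; lra.
Qed.

Let G_monotone k :
  G k.+1 + dot (subgrad k.+1) (X k.+1 - X k.+2) +
    dot (X k.+1 - X k.+2) (X k.+1 - X k.+2) / 2 <= G k /\
  G k + dot (subgrad k) (X k.+2 - X k.+1) +
    dot (X k.+2 - X k.+1) (X k.+2 - X k.+1) / 2 <= G k.+1.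
Proof.
have XB i j : X i - X j = x i - x j by rewrite /X opprB addrA subrK.
rewrite !XB /G.
have := @iterate_subgrad k.+1 (x k.+1) (fine (g (x k.+1))).
rewrite -iterate_fin lexx => /(_ isT).
have := @iterate_subgrad k (x k.+2) (fine (g (x k.+2))).
by rewrite -iterate_fin lexx => /(_ isT); split; lra.
Qed.

Let AS k : dot (A *m S k) (A *m S k) / 2 = series sigma k ^+ 2 * phi (s k).
Proof. by rewrite phiE /S -scalemxAr dotZl dotZr; ring. Qed.

(** Jensen's inequality along s k.+2 = t *: x k.+2 + (1 - t) *: s k.+1.  It
    starts at s 1 = x 1, where s 0 has weight 0, since g may be infinite at s 0. *)
Lemma g_average_le k : (g (s k.+1) <=
  (gbar + series (fun j => sigma j * G j) k.+1 / series sigma k.+1)%:E)%E.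
Proof.
elim: k => [|k IH].
  have s1 : s 1%N = x 1%N.
    rewrite sE /series /= big_nil scale0r addr0 big_nat1 scalerA mulVf ?scale1r //.
    by rewrite gt_eqF.
  rewrite s1 iterate_fin lee_fin /series /= !big_nat1 mulrAC divff ?gt_eqF //.
  by rewrite mul1r /G subrKC.
have p0 := series_gt0 k; have p1 := series_gt0 k.+1; have s0 := sigma_pos k.+1.
pose t := sigma k.+1 / series sigma k.+2.
have t0 : 0 < t by rewrite divr_gt0.
have t1 : t < 1 by rewrite ltr_pdivrMr // mul1r seriesS ltrDl.
have sumE : series sigma k.+2 = sigma k.+1 + series sigma k.+1 by exact: seriesS.
have t1E : 1 - t = series sigma k.+1 / series sigma k.+2.
  rewrite /t -[1](@divff _ (series sigma k.+2)) ?gt_eqF // -mulrBl sumE.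
  by rewrite addrC addKr.
have -> : s k.+2 = t *: x k.+2 + (1 - t) *: s k.+1.
  by rewrite sE scalerDr !scalerA t1E /t ![_^-1 * _]mulrC.
have t01 : 0 < t < 1 by rewrite t0.
have xk : (g (x k.+2) <= (fine (g (x k.+2)))%:E)%E by rewrite -iterate_fin.
apply: le_trans (g_sc t01 xk IH) _; rewrite lee_fin.
have : 0 <= t * (1 - t) * enorm (x k.+2 - s k.+1) ^+ 2.
  by rewrite mulr_ge0 ?sqr_ge0 // mulr_ge0 ?(ltW t0) // subr_ge0 ltW.
have -> : fine (g (x k.+2)) = gbar + G k.+1 by rewrite /G subrKC.
have -> : series (fun j => sigma j * G j) k.+2 / series sigma k.+2 =
   t * G k.+1 +
   (1 - t) * (series (fun j => sigma j * G j) k.+1 / series sigma k.+1).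
  rewrite t1E /t seriesS; field; by rewrite !gt_eqF.
by lra.
Qed.

Let D := sigma 0%N ^+ 2 * (dot (X 0%N) (X 0%N) / (2 * lambda)).

Let D_ge0 : 0 <= D.
Proof. by rewrite mulr_ge0 ?sqr_ge0 // divr_ge0 ?dot_ge0 // mulr_ge0 // ltW. Qed.

(** In the energy, |A *m S k|^2 / 2 is the penalty times the sum of the weights,
    and by Jensen's inequality the weighted gaps dominate that of s k. *)
Lemma penalized_average_le k : (0 < k)%N ->
  (F k (s k) <= (gbar + D / series sigma k)%:E)%E.
Proof.
case: k => // k _; rewrite /F /penalized -leeBrDr // -EFinB.
apply: le_trans (g_average_le k) _; rewrite lee_fin -/(phi _).
have p0 := series_gt0 k.
have := energy_sum lambda_gt0 sigma_pos sigma_rec S0 SS G_le0 k.+1.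
rewrite -/D AS.
have : 0 <= sigma k.+1 ^+ 2 * (dot (X k.+1) (X k.+1) / (2 * lambda)).
  by rewrite mulr_ge0 ?sqr_ge0 // divr_ge0 ?dot_ge0 // mulr_ge0 // ltW.
have : 0 <= series (dissipation A lambda sigma X) k.+1.
  exact: series_dissipation_ge0.
move=> W0 N0 le_D; set q := series sigma _ in p0 le_D *.
have -> : gbar + D / q - q * phi (s k.+1) =
    gbar + (D - q ^+ 2 * phi (s k.+1)) / q.
  by field; rewrite gt_eqF.
by rewrite lerD2l ler_pM2r ?invr_gt0 //; lra.
Qed.

Let sigma_linear := sigma_ge_linear lambda_gt0 tau0_gt0 tauE sigmaE.

Lemma series_near_ge (B : R) : \forall k \near \oo, B <= series sigma k.
Proof.
have [c c0 cs] := sigma_linear.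
near=> k.
apply: le_trans (series_sigma_ge c0 cs k); rewrite -ler_pdivrMl ?divr_gt0 //.
apply: (@le_trans _ _ k%:R); first by near: k; exact: nbhs_infty_ger.
by rewrite -natrX ler_nat -mulnn; case: (k) => // i; rewrite leq_pmulr.
Unshelve. all: by end_near. Qed.

Let series_homo k j : (k <= j)%N -> series sigma k <= series sigma j.
Proof.
move=> /subnK <-; elim: (j - k)%N => [//|i IH].
by rewrite addSn seriesS (le_trans IH) // lerDr ltW.
Qed.

(** ** Minimizers of the penalized problems *)

Let xhat k := minimizer (F k).

Let F_proper k : eproper (F k).
Proof. exact: penalized_proper. Qed.

Let F_convex k : strongly_convex 1 (F k).
Proof. exact: penalized_strongly_convex. Qed.

Let F_lsc k : lower_semicontinuous (F k).
Proof. exact: penalized_lsc. Qed.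

Let xhat_argmin k : argmin setT (F k) (xhat k).
Proof. exact: penalized_argmin. Qed.

Let xhatE k := argmin_fin (F_proper k) (xhat_argmin k).

Let F_xbar k : F k xbar = gbar%:E.
Proof.
rewrite /F /penalized -/(phi xbar) phiE subrr mulmx0 dot0l mul0r mulr0 adde0.
exact: g_xbar.
Qed.

Let F_homo k j y : (k <= j)%N -> (F k y <= F j y)%E.
Proof.
move=> kj; rewrite /F /penalized leeD2l // lee_fin.
by rewrite ler_wpM2r ?phi_ge0 ?series_homo.
Qed.

Let val_le k : fine (F k (xhat k)) <= gbar.
Proof.
by have [_ _ /(_ xbar I)] := xhat_argmin k; rewrite F_xbar xhatE lee_fin.
Qed.

Let val_growth k j : (k <= j)%N ->
  fine (F k (xhat k)) + 1 / 2 * enorm (xhat j - xhat k) ^+ 2 <=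
  fine (F j (xhat j)).
Proof.
move=> kj.
have xj : (F k (xhat j) <= (fine (F j (xhat j)))%:E)%E by rewrite -xhatE F_homo.
exact: argmin_growth (F_proper k) ltr01 (@F_convex k) (xhat_argmin k) xj.
Qed.

(** The optimal values of the penalized problems increase and are bounded by
    the optimal value of the constrained one, so their minimizers are Cauchy by
    quadratic growth.  Every penalized objective is at most that value at the
    limit, which is therefore feasible and optimal. *)
Lemma xhat_cvg : xhat @ \oo --> xbar.
Proof.
pose v k := fine (F k (xhat k)).
have v_homo : {homo v : k j / (k <= j)%N >-> k <= j}.
  move=> k j /val_growth; apply: le_trans.
  by rewrite lerDl mulr_ge0 ?sqr_ge0 // divr_ge0.
have v_cvg : cvgn v.
  apply: nondecreasing_is_cvgn => //; exists gbar => _ [k _ <-]; exact: val_le.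
have [l xl] : exists l : 'cV[R]_n, xhat @ \oo --> l.
  apply: (@enorm_cauchy_cvg _ _ _ (fun k => 2 * (limn v - v k))) => [k j kj|].
    have := le_trans (val_growth kj) (nondecreasing_cvgn_le v_homo v_cvg j).
    by rewrite addrC -lerBrDr mul1r ler_pdivrMl.
  rewrite -[0](mulr0 2) -(subrr (limn v)); apply: cvgMr; apply: cvgB => //.
  exact: cvg_cst.
have Fl k : (F k l <= gbar%:E)%E.
  apply: (lsc_le_lim (@F_lsc k) xl) => e e0; exists k => // j /= kj.
  apply: le_trans (F_homo (xhat j) kj) _; rewrite xhatE lee_fin.
  by have := val_le j; lra.
have F0E : F 0%N l = g l.
  by rewrite /F /penalized /series /= big_nil mul0r adde0.
have gl : (g l <= gbar%:E)%E by rewrite -F0E.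
have glE := eproper_fin g_proper gl.
have phil : phi l = 0.
  apply/eqP; rewrite eq_le phi_ge0 andbT leNgt; apply/negP => pl.
  have [k _ /(_ k (leqnn k)) /= Bk] :=
    series_near_ge ((gbar - fine (g l) + 1) / phi l).
  have := Fl k; rewrite /F /penalized glE -EFinD lee_fin -/(phi l).
  by rewrite ler_pdivrMr // in Bk; lra.
suff : solution_set A b g l by rewrite S_eq => <-.
split; last 2 first.
- exact: le_lt_trans gl (ltry _).
- move=> y yA; apply: le_trans gl _; rewrite -g_xbar.
  by have [_ _] := xbar_sol; exact.
apply/(lsq_argminP xbar_argmin); apply: dot_eq0.
by move: phil; rewrite phiE; lra.
Qed.

Lemma F_xhat_le k : (F k (xhat k) <= F k (s k))%E.
Proof. by have [_ _] := xhat_argmin k; exact. Qed.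

Lemma series_near_small (e : R) : 0 < e ->
  \forall k \near \oo, D / series sigma k <= e.
Proof.
move=> e0; near=> k.
have k0 : (0 < k)%N by near: k; exact: nbhs_infty_gt.
have p0 : 0 < series sigma k by case: (k) k0 => // j _; exact: series_gt0.
rewrite ler_pdivrMr // mulrC -ler_pdivrMr //.
by near: k; exact: series_near_ge.
Unshelve. all: by end_near. Qed.

(** ** Convergence without a multiplier *)

(** Quadratic growth bounds the distance of s k to xhat k by the gap of values,
    which tends to 0 because g is lower semicontinuous at xbar. *)
Lemma average_cvg : s @ \oo --> xbar.
Proof.
apply/cvg_enormP => e e0; pose d := e ^+ 2 / 32.
have d0 : 0 < d by rewrite divr_gt0 ?exprn_gt0.
have /cvg_enormP xh := xhat_cvg.
near=> k.
have k0 : (0 < k)%N by near: k; exact: nbhs_infty_gt.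
have near1 : enorm (xhat k - xbar) < e / 2.
  by near: k; apply: xh; rewrite divr_gt0.
have near2 : ((gbar - d)%:E < g (xhat k))%E.
  near: k; apply: lsc_near g_lsc xhat_cvg _.
  by rewrite g_xbar lte_fin; lra.
have near3 : D / series sigma k <= d by near: k; exact: series_near_small.
have := argmin_growth (F_proper k) ltr01 (@F_convex k) (xhat_argmin k)
  (penalized_average_le k0).
have : gbar - d < fine (F k (xhat k)).
  rewrite -lte_fin -xhatE; apply: lt_le_trans near2 _.
  by rewrite /F /penalized leeDl // lee_fin mulr_ge0 ?phi_ge0.
move=> lo up.
have : enorm (s k - xhat k) ^+ 2 < (e / 2) ^+ 2.
  by move: (d0) near3 lo up; rewrite /d; lra.
rewrite ltr_sqr ?nnegrE ?enorm_ge0 ?divr_ge0 ?ltW // => sx.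
have -> : s k - xbar = (s k - xhat k) + (xhat k - xbar) by rewrite addrA subrK.
by apply: le_lt_trans (enormD _ _) _; lra.
Unshelve. all: by end_near. Qed.

(** The value g (s k) cannot fall short of gbar in the limit, so the upper bound
    on F k (s k) leaves nothing of order 1 to its penalty term. *)
Lemma lsq_average_littleo :
  (fun k => phi (s k)) =o_\oo (fun k => (k%:R ^- 2 : R^o)).
Proof.
have [c c0 cs] := sigma_linear.
apply: littleo_natX => e e0; pose d := e * c / 4.
have d0 : 0 < d by rewrite divr_gt0 // mulr_gt0.
near=> k.
have k0 : (0 < k)%N by near: k; exact: nbhs_infty_gt.
have near2 : ((gbar - d)%:E < g (s k))%E.
  near: k; apply: lsc_near g_lsc average_cvg _.
  by rewrite g_xbar lte_fin; lra.
have near3 : D / series sigma k <= d by near: k; exact: series_near_small.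
rewrite ger0_norm ?phi_ge0 // ler_pdivlMr ?exprn_gt0 ?ltr0n //.
have : series sigma k * phi (s k) <= 2 * d.
  have := penalized_average_le k0.
  rewrite /F /penalized -/(phi _) -leeBrDr // -EFinB.
  by move/(lt_le_trans near2); rewrite lte_fin; lra.
have := series_sigma_ge c0 cs k; have := phi_ge0 (s k); set p := phi _.
set q := series _ _; set k2 := _ ^+ 2 => p0 qk qp.
have : c / 2 * k2 * p <= q * p by rewrite ler_wpM2r.
have dE : 2 * d = c / 2 * e by rewrite /d; field.
move=> kp; rewrite -(ler_pM2l (_ : 0 < c / 2)) ?divr_gt0 //.
by rewrite -dE; lra.
Unshelve. all: by end_near. Qed.

Lemma series_inv_le : exists2 C, 0 < C &
  forall k, (0 < k)%N -> (series sigma k)^-1 <= C / k%:R ^+ 2.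
Proof.
have [c c0 cs] := sigma_linear; exists (c / 2)^-1.
  by rewrite invr_gt0 divr_gt0.
case=> // k _; rewrite -invfM lef_pV2 ?posrE ?series_gt0 //.
  by rewrite (series_sigma_ge c0).
by rewrite mulr_gt0 ?divr_gt0 ?exprn_gt0.
Qed.

Lemma penalized_average_rate : exists C : R, forall k, (0 < k)%N ->
  (F k (s k) - gbar%:E <= (C / k%:R ^+ 2)%:E)%E.
Proof.
have [C C0 CP] := series_inv_le; exists (D * C) => k k0.
rewrite leeBlDr // -EFinD; apply: le_trans (penalized_average_le k0) _.
by rewrite lee_fin addrC lerD2r -mulrA ler_wpM2l // CP.
Qed.

(** ** Rates in the presence of a multiplier *)

(** The primal part of a saddle point is feasible, hence optimal, hence xbar;
    its dual part then gives an affine minorant of g whose slope lies in the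
    range of A^T. *)
Lemma strong_duality_multiplier : strong_duality A b g ->
  exists v : 'cV[R]_m, forall y (c : R), (g y <= c%:E)%E ->
    gbar - dot v (A *m (y - xbar)) <= c.
Proof.
move=> [xs [us saddle]].
have LE y u : lagrangian A b g y u = (g y + (dot u (lsq_grad A b y))%:E)%E.
  by rewrite /lagrangian /lsq_grad mulmxBr mulmxA.
have gxsE : g xs = (fine (g xs))%:E.
  have [_] := saddle xbar us; rewrite !LE g_xbar -EFinD -leeBrDr // -EFinB.
  exact: eproper_fin.
have grad0 : lsq_grad A b xs = 0.
  apply: dot_eq0; apply/eqP; rewrite eq_le dot_ge0 andbT.
  have [+ _] := saddle xs (us + lsq_grad A b xs).
  by rewrite !LE gxsE -!EFinD lee_fin dotDl; lra.
have min_xs y (c : R) : (g y <= c%:E)%E ->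
    fine (g xs) <= c + dot us (lsq_grad A b y).
  move=> yc; have yE := eproper_fin g_proper yc.
  have [_] := saddle y us; rewrite !LE gxsE yE grad0 -!EFinD lee_fin.
  rewrite dotC dot0l addr0; move: yc; rewrite yE lee_fin; lra.
have xs_xbar : xs = xbar.
  suff : solution_set A b g xs by rewrite S_eq.
  split; last 2 first.
  - by rewrite gxsE ltry.
  - move=> y yA; have := min_xs y.
    rewrite (lsq_grad_argmin yA) dotC dot0l gxsE.
    case yE : (g y) => [r||].
    + by move=> /(_ r (lexx _)); rewrite addr0 lee_fin.
    + by rewrite leey.
    + by have [/(_ y)] := g_proper; rewrite yE.
  split=> [//||y _]; first exact: ltry.
  by rewrite lee_fin (lsqE _ _ xs y) grad0 dot0l addr0 lerDl divr_ge0 ?sqr_ge0.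
exists (A *m us) => y c /min_xs.
by rewrite xs_xbar -/gbar (lsq_gradE xbar_argmin) dot_mulmxl; lra.
Qed.

Section Multiplier.
Variable v : 'cV[R]_m.
Hypothesis v_multiplier : forall y (c : R), (g y <= c%:E)%E ->
  gbar - dot v (A *m (y - xbar)) <= c.

Let E := D + dot v v.

Let E_ge0 : 0 <= E.
Proof. by rewrite addr_ge0 ?dot_ge0. Qed.

Let energy_bound k :
  dot (A *m S k) (A *m S k) / 4 +
    sigma k ^+ 2 * (dot (X k) (X k) / (2 * lambda)) +
    series (dissipation A lambda sigma X) k / 2 <= E.
Proof.
apply: energy_multiplier => // j.
have := v_multiplier (y := x j.+1) (c := fine (g (x j.+1))).
by rewrite -iterate_fin lexx => /(_ isT); rewrite /G -/(X _); lra.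
Qed.

Let kinetic_ge0 k : 0 <= sigma k ^+ 2 * (dot (X k) (X k) / (2 * lambda)).
Proof. by rewrite mulr_ge0 ?sqr_ge0 // divr_ge0 ?dot_ge0 // mulr_ge0 // ltW. Qed.

Let dissip_ge0 k : 0 <= series (dissipation A lambda sigma X) k.
Proof. exact: series_dissipation_ge0. Qed.

Let AS_le k : dot (A *m S k) (A *m S k) <= 4 * E.
Proof.
by have := energy_bound k; have := kinetic_ge0 k; have := dissip_ge0 k; lra.
Qed.

Lemma iterate_rate : exists2 C, 0 < C &
  forall k, (0 < k)%N -> enorm (x k - xbar) <= C / k%:R ^+ 1.
Proof.
have [c c0 cs] := sigma_linear; exists (Num.sqrt (2 * lambda * E) / c + 1).
  by rewrite ltr_wpDl // divr_ge0 ?sqrtr_ge0 // ltW.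
move=> k k0; rewrite expr1 ler_pdivlMr ?ltr0n //.
have ck : c * k%:R <= sigma k.
  by apply: le_trans (cs k); rewrite ler_pM2l // ler_nat.
have sX : sigma k * enorm (X k) <= Num.sqrt (2 * lambda * E).
  rewrite -ler_sqr ?nnegrE ?mulr_ge0 ?enorm_ge0 ?sqrtr_ge0 ?(ltW (sigma_pos k)) //.
  rewrite sqr_sqrtr ?mulr_ge0 ?(ltW lambda_gt0) // exprMn enorm_sqr.
  have := energy_bound k; have := dot_ge0 (A *m S k); have := dissip_ge0 k.
  move=> h1 h2 h3.
  have : sigma k ^+ 2 * (dot (X k) (X k) / (2 * lambda)) <= E by lra.
  by rewrite mulrA ler_pdivrMr ?mulr_gt0 // (mulrC E).
apply: ler_wpDr => //; rewrite -/(X k) ler_pdivlMr // -mulrA mulrC (mulrC _ c).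
by apply: le_trans sX; rewrite ler_wpM2r ?enorm_ge0.
Qed.

Lemma iterate_cvg : x @ \oo --> xbar.
Proof.
apply/cvg_enormP => e e0; have [C C0 CP] := iterate_rate.
near=> k.
have k0 : (0 < k)%N by near: k; exact: nbhs_infty_gt.
apply: le_lt_trans (CP k k0) _.
rewrite ltr_pdivrMr ?exprn_gt0 ?ltr0n // expr1 mulrC -ltr_pdivrMr //.
by near: k; exact: nbhs_infty_gtr.
Unshelve. all: by end_near. Qed.

(** A single term of the dissipation would only give the order k ^- 2; in
    residual_le_dissipation the residual is multiplied by the sum of the
    sigma j ^+ 2, which is at least of order k ^+ 3. *)
Lemma lsq_iterate_rate : exists C : R, forall k, (0 < k)%N ->
  phi (x k) <= C / k%:R ^+ 3.
Proof.
have [c c0 cs] := sigma_linear; exists (3 * E / c ^+ 2); case=> // k _.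
have := residual_le_dissipation lambda_gt0 lambda_le sigma_pos sigma_rec
  sigma_incr SS G_monotone k.
have := energy_bound k.+2; have := kinetic_ge0 k.+2.
have := dot_ge0 (A *m S k.+2) => h1 h2 h3 h4.
have rE : residual A lambda X k * series (fun j => sigma j ^+ 2) k.+1 <= 2 * E.
  by lra.
have r0 : 0 <= residual A lambda X k.
  by rewrite addr_ge0 ?dot_ge0 // step_norm2_ge0.
have w := series_sigma_sqr_ge lambda_gt0 tau0_gt0 tauE sigmaE c0 cs k.+1.
have c20 : 0 < c ^+ 2 by rewrite exprn_gt0.
have : residual A lambda X k * (c ^+ 2 / 3 * k.+1%:R ^+ 3) <= 2 * E.
  by apply: le_trans rE; rewrite ler_wpM2l.
have phi_r : 2 * phi (x k.+1) <= residual A lambda X k.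
  rewrite phiE /residual -/(X k.+1) mulrC divfK ?pnatr_eq0 // lerDl.
  exact: step_norm2_ge0.
rewrite ler_pdivlMr ?exprn_gt0 // ler_pdivlMr //.
set K := k.+1%:R ^+ 3 => rK.
have : 2 * phi (x k.+1) * (c ^+ 2 / 3 * K) <=
    residual A lambda X k * (c ^+ 2 / 3 * K).
  by rewrite ler_wpM2r // mulr_ge0 ?exprn_ge0 // divr_ge0 // ltW.
by lra.
Qed.

Lemma lsq_average_rate : exists C : R, forall k, (0 < k)%N ->
  phi (s k) <= C / k%:R ^+ 4.
Proof.
have [C C0 CP] := series_inv_le; exists (2 * E * C ^+ 2); case=> // k _.
have q0 := series_gt0 k.
have -> : phi (s k.+1) =
    (dot (A *m S k.+1) (A *m S k.+1) / 2) * (series sigma k.+1)^-1 ^+ 2.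
  by rewrite AS; field; rewrite gt_eqF.
apply: (@le_trans _ _ (2 * E * (C / k.+1%:R ^+ 2) ^+ 2)).
  apply: ler_pM.
  - by rewrite divr_ge0 ?dot_ge0.
  - exact: sqr_ge0.
  - by have := AS_le k.+1; lra.
  - rewrite ler_sqr ?nnegrE ?CP // ?invr_ge0 ?(ltW q0) //.
    by rewrite divr_ge0 ?exprn_ge0 // ltW.
by rewrite exprMn exprVn -exprM mulrA.
Qed.

(** The multiplier bounds the value from below by a multiple of the norm of
    A *m (s k - xbar), which is A *m S k divided by the sum of the weights. *)
Lemma g_average_ge : exists C : R, forall k, (0 < k)%N ->
  ((gbar - C / k%:R ^+ 2)%:E <= g (s k))%E.
Proof.
have [C C0 CP] := series_inv_le.
exists (enorm v * Num.sqrt (4 * E) * C); case=> // k _.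
have q0 := series_gt0 k.
have AsE : A *m (s k.+1 - xbar) = (series sigma k.+1)^-1 *: (A *m S k.+1).
  by rewrite /S -scalemxAr scalerA mulVf ?scale1r // gt_eqF.
have ASn : enorm (A *m S k.+1) <= Num.sqrt (4 * E) by rewrite ler_wsqrtr ?AS_le.
have : dot v (A *m (s k.+1 - xbar)) <=
    enorm v * Num.sqrt (4 * E) * C / k.+1%:R ^+ 2.
  apply: le_trans (dot_le_enorm _ _) _.
  rewrite AsE enormZ -!mulrA ler_wpM2l ?enorm_ge0 // mulrC.
  apply: ler_pM; rewrite ?enorm_ge0 // ger0_norm ?invr_ge0 ?(ltW q0) //.
  exact: CP.
have := @v_multiplier (s k.+1).
case gE : (g (s k.+1)) => [r||].
- move=> /(_ r (lexx _)) vr dv; rewrite lee_fin (le_trans _ vr) //.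
  by rewrite lerD2l lerN2.
- by rewrite leey.
- by have [/(_ (s k.+1))] := g_proper; rewrite gE.
Qed.

End Multiplier.

Lemma g_le_penalized k y : (g y <= F k y)%E.
Proof. by rewrite /F /penalized leeDl // lee_fin mulr_ge0 ?phi_ge0. Qed.

(** Both values lie between the lower bound for g (s k) given by the multiplier
    and the upper bound for F k (s k). *)
Lemma average_value_rates (v : 'cV[R]_m) :
  (forall y (c : R), (g y <= c%:E)%E -> gbar - dot v (A *m (y - xbar)) <= c) ->
  ebigO (fun k => F k (s k) - gbar%:E)%E (fun k => k%:R ^- 2) /\
  ebigO (fun k => g (s k) - gbar%:E)%E (fun k => k%:R ^- 2).
Proof.
move=> /g_average_ge[C lo]; have [C' up] := penalized_average_rate.
pose B := Num.max C C'.
have BC k : C / k%:R ^+ 2 <= B / k%:R ^+ 2.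
  by rewrite ler_wpM2r ?invr_ge0 ?exprn_ge0 // le_max lexx.
have BC' k : C' / k%:R ^+ 2 <= B / k%:R ^+ 2.
  by rewrite ler_wpM2r ?invr_ge0 ?exprn_ge0 // le_max lexx orbT.
have glo k : (0 < k)%N -> ((- (B / k%:R ^+ 2))%:E <= g (s k) - gbar%:E)%E.
  move=> k0; rewrite leeBrDr // -EFinD; apply: le_trans (lo k k0).
  by rewrite lee_fin addrC lerD2l lerN2.
have Fup k : (0 < k)%N -> (F k (s k) - gbar%:E <= (B / k%:R ^+ 2)%:E)%E.
  by move=> k0; apply: le_trans (up k k0) _; rewrite lee_fin.
split; apply: (@ebigO_natX _ _ _ B) => k k0; split; rewrite ?glo ?Fup //.
  by apply: le_trans (glo k k0) _; rewrite leeD2r // g_le_penalized.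
by apply: le_trans (Fup k k0); rewrite leeD2r // g_le_penalized.
Qed.

End Convergence.

(** * The convergence theorem *)

(* series sigma k is Sigma_{k-1}, the sum of the first k terms of sigma. *)
Theorem theorem2 (R : realType) (m n : nat)
  (g : 'cV[R]_n -> \bar R) (A : 'M[R]_(m, n)) (b : 'cV[R]_m)
  (xbar : 'cV[R]_n) (lambda : R)
  (tau sigma : nat -> R) (x s z : nat -> 'cV[R]_n)
  (g_proper : eproper g)
  (g_lsc : lower_semicontinuous g)
  (g_sc : strongly_convex1 g)
  (S_eq : solution_set A b g = [set xbar])
  (lambda_gt0 : 0 < lambda)
  (lambda_le : lambda * opnorm A ^+ 2 <= 1)
  (tau0_gt0 : 0 < tau 0%N)
  (tauE : forall k, tau k.+1 = tau k / Num.sqrt (1 + tau k))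
  (sigmaE : forall k, sigma k = lambda / tau k)
  (s0E : s 0%N = x 0%N)
  (zE : forall k, z k =
     (series sigma k.+1)^-1 *: (sigma k *: x k + series sigma k *: s k))
  (xE : forall k, x k.+1 =
     prox (tau k) g
       (x k - (tau k * series sigma k.+1) *: lsq_grad A b (z k)))
  (sE : forall k, s k.+1 =
     (series sigma k.+1)^-1 *: (sigma k *: x k.+1 + series sigma k *: s k)) :
  let f := lsq A b in
  let fstar := lsq_min A b in
  let gstar := optimal_value A b g in
  let F := fun k => penalized A b g (series sigma k) in
  let xhat := fun k => minimizer (F k) in
  [/\ s @ \oo --> xbar,
      (forall k, F k (xhat k) - gstar <= F k (s k) - gstar)%E,
      (exists C : R, forall k, (1 <= k)%N ->
         (F k (s k) - gstar <= (C / k%:R ^+ 2)%:E)%E) &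
      (fun k => f (s k) - fstar) =o_\oo (fun k => (k%:R ^- 2 : R^o))]
  /\
  (strong_duality A b g ->
   [/\ x @ \oo --> xbar,
       (fun k => enorm (x k - xbar)) =O_\oo (fun k => (k%:R ^- 1 : R^o)),
       (fun k => f (x k) - fstar) =O_\oo (fun k => (k%:R ^- 3 : R^o)) &
       (fun k => f (s k) - fstar) =O_\oo (fun k => (k%:R ^- 4 : R^o))] /\
   ebigO (fun k => F k (s k) - gstar)%E (fun k => k%:R ^- 2) /\
   ebigO (fun k => g (s k) - gstar)%E (fun k => k%:R ^- 2)).
Proof.
have gc := strongly_convex1P g_proper g_sc.
have [xbar_argmin _ _] : solution_set A b g xbar by rewrite S_eq.
have phiE := lsqB_min xbar_argmin.
move=> f fstar gstar F xhat.
rewrite /gstar (optimal_valueE g_proper S_eq).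
have phi_norm y : `|f y - fstar| = f y - fstar.
  by rewrite /f /fstar phiE ger0_norm // divr_ge0 ?sqr_ge0.
split; [split|].
- exact: average_cvg g_proper g_lsc gc S_eq lambda_gt0 lambda_le
    tau0_gt0 tauE sigmaE zE xE sE.
- move=> k; rewrite leeD2r //.
  exact: F_xhat_le g_proper g_lsc gc lambda_gt0 tau0_gt0 tauE sigmaE k.
- exact: penalized_average_rate g_proper g_lsc gc S_eq lambda_gt0 lambda_le
    tau0_gt0 tauE sigmaE zE xE sE.
- exact: lsq_average_littleo g_proper g_lsc gc S_eq lambda_gt0 lambda_le
    tau0_gt0 tauE sigmaE zE xE sE.
move=> /(strong_duality_multiplier g_proper S_eq)[v vP].
split; last first.
  exact (average_value_rates g_proper g_lsc gc S_eq lambda_gt0 lambda_le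
    tau0_gt0 tauE sigmaE zE xE sE vP).
split.
- exact (iterate_cvg g_proper g_lsc gc S_eq lambda_gt0 lambda_le
    tau0_gt0 tauE sigmaE zE xE sE vP).
- have [C _ CP] := iterate_rate g_proper g_lsc gc S_eq lambda_gt0 lambda_le
    tau0_gt0 tauE sigmaE zE xE sE vP.
  apply: (@bigO_natX _ _ 1 C) => k k0; rewrite ger0_norm ?enorm_ge0 //.
  exact: CP.
- have [C CP] := lsq_iterate_rate g_proper g_lsc gc S_eq lambda_gt0 lambda_le
    tau0_gt0 tauE sigmaE zE xE sE vP.
  by apply: (@bigO_natX _ _ 3 C) => k k0; rewrite phi_norm; exact: CP.
- have [C CP] := lsq_average_rate g_proper g_lsc gc S_eq lambda_gt0 lambda_le
    tau0_gt0 tauE sigmaE zE xE sE vP.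
  by apply: (@bigO_natX _ _ 4 C) => k k0; rewrite phi_norm; exact: CP.
Qed.
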